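(* Let $G$ be an unweighted undirected graph with $n$ vertices and $m$ edges, let $s\in V(G)$, let $\alpha\ge 1$, $\beta\ge 0$, and let $S$ be an $(\alpha,\beta)$-spanner of $G$ with $\sigma=\sigma(n,m)$ edges. Then, given $G$, $s$ and $S$, one can compute in polynomial time an $(\alpha,\beta)$-VABFS of $G$ with respect to $s$ having $O(\sigma+n\log n)$ edges.
   Context: Distances $d_X(x,y)$ in an unweighted graph $X$ are numbers of edges on a shortest $x$–$y$ path ($+\infty$ if none). For a vertex $u$, $X-u$ denotes $X$ with $u$ and its incident edges removed. An $(\alpha,\beta)$-spanner of $G$ is a spanning subgraph $S$ of $G$ such that $d_S(x,y)\le \alpha\, d_G(x,y)+\beta$ for all $x,y\in V(G)$. An $(\alpha,\beta)$-VABFS (vertex-fault-tolerant $(\alpha,\beta)$-approximate BFS structure) of $G$ with respect to $s$ is a spanning subgraph $H$ of $G$ such that for every vertex $u\in V(G)\setminus\{s\}$ and every $t\in V(G)\setminus\{u\}$, $d_{H-u}(s,t)\le \alpha\, d_{G-u}(s,t)+\beta$. *)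

(* Defs.v *)
From HB Require Import structures.
From mathcomp Require Import all_boot all_order all_algebra.
From mathcomp Require Import all_classical all_reals all_analysis.

Set Implicit Arguments.
Unset Strict Implicit.
Unset Printing Implicit Defensive.

Import Order.TTheory GRing.Theory Num.Theory.

Local Open Scope ring_scope.

Record sgraph (V : finType) := SGraph {
  adj :> rel V;
  adj_sym : symmetric adj;
  adj_irr : irreflexive adj
}.

Section Graphs.
Variable V : finType.
Implicit Types (G H S : sgraph V) (s t u x y : V).

Definition edges G : {set {set V}} :=
  [set E | [exists x, exists y, G x y && (E == [set x; y])]].

Definition nb_edges G : nat := #|edges G|.

Definition spanning_subgraph H G : Prop := subrel H G.

(* The graph G - u is represented on the same vertex type, with u isolated;
   it is only ever used for distances between vertices other than u. *)
Definition del_adj G u : rel V := [rel x y | [&& x != u, y != u & G x y]].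

Lemma del_adj_sym G u : symmetric (del_adj G u).
Proof. by move=> x y; rewrite /del_adj /= (adj_sym G) andbCA. Qed.

Lemma del_adj_irr G u : irreflexive (del_adj G u).
Proof. by move=> x; rewrite /del_adj /= (adj_irr G) !andbF. Qed.

Definition del_vertex G u : sgraph V :=
  SGraph (del_adj_sym G u) (del_adj_irr G u).

Variable R : realType.

(* The infimum of the empty set of walk lengths is +oo. *)
Definition dist G x y : \bar R :=
  ereal_inf [set (size p)%:R%:E | p in [set p | path G x p /\ last x p = y]].

Definition spanner (alpha beta : R) G S : Prop :=
  spanning_subgraph S G /\
  forall x y, (dist S x y <= alpha%:E * dist G x y + beta%:E)%E.

Definition vabfs (alpha beta : R) G s H : Prop :=
  spanning_subgraph H G /\
  forall u t, u != s -> t != u ->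
    (dist (del_vertex H u) s t
       <= alpha%:E * dist (del_vertex G u) s t + beta%:E)%E.

End Graphs.

(* Model of computation: while programs over natural-number variables and
   two-dimensional arrays, i.e. a structured random access machine, with unit
   cost for each instruction and each test. The only arithmetic operations are
   addition and truncated subtraction, so a given program run for t steps on an
   input of size N only handles numbers and array indices with O(t + log N)
   bits: polynomially many steps means polynomial time on a Turing machine. *)
Inductive expr :=
  | Cst of nat
  | Var of nat
  | Cell of nat & expr & expr
  | Plus of expr & expr
  | Minus of expr & expr.

Inductive cmd :=
  | Skip
  | Assign of nat & expr
  | Store of nat & expr & expr & expr
  | Seq of cmd & cmd
  | If of expr & cmd & cmd
  | While of expr & cmd.

Record state := State {
  vars : nat -> nat;
  arrs : nat -> nat -> nat -> nat
}.

Fixpoint eval (st : state) (e : expr) : nat :=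
  match e with
  | Cst k => k
  | Var x => vars st x
  | Cell a e1 e2 => arrs st a (eval st e1) (eval st e2)
  | Plus e1 e2 => (eval st e1 + eval st e2)%N
  | Minus e1 e2 => (eval st e1 - eval st e2)%N
  end.

Definition set_var (st : state) (x v : nat) : state :=
  State (fun y => if y == x then v else vars st y) (arrs st).

Definition set_cell (st : state) (a i j v : nat) : state :=
  State (vars st) (fun b k l =>
    if [&& b == a, k == i & l == j] then v else arrs st b k l).

(* [exec c st t st'] : started in st, c halts in state st' after t steps.
   Tests succeed on nonzero values. *)
Inductive exec : cmd -> state -> nat -> state -> Prop :=
  | exec_Skip st : exec Skip st 1 st
  | exec_Assign st x e : exec (Assign x e) st 1 (set_var st x (eval st e))
  | exec_Store st a e1 e2 e :
      exec (Store a e1 e2 e) st 1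
        (set_cell st a (eval st e1) (eval st e2) (eval st e))
  | exec_Seq c1 c2 st st1 st2 t1 t2 :
      exec c1 st t1 st1 -> exec c2 st1 t2 st2 ->
      exec (Seq c1 c2) st (t1 + t2)%N st2
  | exec_IfT e c1 c2 st st' t :
      eval st e != 0%N -> exec c1 st t st' -> exec (If e c1 c2) st t.+1 st'
  | exec_IfF e c1 c2 st st' t :
      eval st e == 0%N -> exec c2 st t st' -> exec (If e c1 c2) st t.+1 st'
  | exec_WhileT e c st st1 st2 t1 t2 :
      eval st e != 0%N -> exec c st t1 st1 -> exec (While e c) st1 t2 st2 ->
      exec (While e c) st (t1 + t2).+1 st2
  | exec_WhileF e c st :
      eval st e == 0%N -> exec (While e c) st 1 st.

Definition adj_array (n : nat) (G : sgraph 'I_n) (i j : nat) : nat :=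
  if (insub i, insub j) is (Some x, Some y) then G x y else false.

(* Variables 0 and 1 hold n and s, arrays 0 and 1 the adjacency matrices of
   G and S; everything else is 0. *)
Definition input (n : nat) (G : sgraph 'I_n) (s : 'I_n) (S : sgraph 'I_n) :
    state :=
  State
    (fun x => if x == 0%N then n else if x == 1%N then nat_of_ord s else 0%N)
    (fun a => if a == 0%N then adj_array G
              else if a == 1%N then adj_array S else fun _ _ => 0%N).

(* The output graph is read off array 2. *)
Definition outputs (n : nat) (st : state) (H : sgraph 'I_n) : Prop :=
  forall x y : 'I_n, arrs st 2 x y = H x y.

(* Main.v *)
Require Import Defs.
From HB Require Import structures.
From mathcomp Require Import all_boot all_order all_algebra.
From mathcomp Require Import all_classical all_reals all_analysis.
From mathcomp Require Import zify ring lra.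

(* Let T be a breadth-first tree of G rooted at s. A child v of u is heavy if its
   subtree contains more than half of the subtree of u. For a failing vertex u
   let D be the subtree of its heavy child v and O the set of its other proper
   descendants. The structure H consists of S, T and, for every u,
   - for each t in O, the last edge of a shortest path from s to t in G - u, and
     of one in G - u - D;
   - one edge entering D on a shortest path from s to v in G - u.
   Each t lies in at most log_2 n of the sets O, since every time it does the
   subtree size is halved; this gives the bound on the number of edges.

   Vertices outside the subtree of u are reached through T. By induction H - u
   preserves the distances from s in G - u - D, hence also the distance from s to
   v. For t in D consider the last vertex x before a shortest path from s to t in
   G - u enters D: either the path of S from x to t avoids u, or it is so long
   that the path from s to v followed by the tree path to t does not exceed it.
   For t in O one follows last edges of shortest paths back to a previous case. *)

Import Order.TTheory GRing.Theory Num.Theory.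

Set Implicit Arguments.
Unset Strict Implicit.
Unset Printing Implicit Defensive.

(** * Walks and distances *)

Section Walks.
Variable V : finType.
Implicit Types (r : rel V) (x y z : V) (k l : nat).

(** Walks of at most k steps, as a boolean recursion in k: the program runs the same recursion round
    by round. *)
Fixpoint reach r k x y : bool :=
  if k is l.+1 then reach r l x y || [exists z, reach r l x z && r z y]
  else x == y.

(* This is [#|V|] when y is unreachable from x. *)
Definition nd r x y : nat := \sum_(k < #|V|) ~~ reach r k x y.

Lemma reach_refl r k x : reach r k x x.
Proof. by elim: k => //= k ->. Qed.

Lemma reach_mono r k l x y : k <= l -> reach r k x y -> reach r l x y.
Proof.
by move=> /subnK <-; elim: (l - k) => //= m IH /IH ->.
Qed.

Lemma reach_step r k x y z : reach r k x y -> r y z -> reach r k.+1 x z.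
Proof. by move=> h1 h2 /=; apply/orP; right; apply/existsP; exists y; rewrite h1. Qed.

Lemma reach_cat r k l x y z :
  reach r k x y -> reach r l y z -> reach r (k + l) x z.
Proof.
move=> h; elim: l z => [|l IH] z /=; first by move=> /eqP <-; rewrite addn0.
rewrite addnS => /orP[/IH|/existsP[w /andP[/IH h1 h2]]].
  exact: reach_mono.
exact: reach_step h1 h2.
Qed.

Lemma reach1 r x y : r x y -> reach r 1 x y.
Proof. by move=> h; apply: reach_step h; apply: reach_refl. Qed.

Lemma reach_sub r r' k x y : subrel r r' -> reach r k x y -> reach r' k x y.
Proof.
move=> rr'; elim: k y => //= k IH y /orP[/IH -> //|/existsP[z /andP[/IH h1 /rr' h2]]].
by apply/orP; right; apply/existsP; exists z; rewrite h1.
Qed.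

Lemma reach_sym r k x y : symmetric r -> reach r k x y -> reach r k y x.
Proof.
move=> rs; elim: k y => [|k IH] y; first by rewrite /= eq_sym.
case/orP=> [/IH|/existsP[z /andP[/IH h1 h2]]]; first exact: reach_mono.
by rewrite -add1n; apply: reach_cat h1; apply: reach1; rewrite rs.
Qed.

Lemma reach_path r x p : path r x p -> reach r (size p) x (last x p).
Proof.
elim/last_ind: p => //= p y IH; rewrite rcons_path size_rcons last_rcons.
by case/andP=> /IH; apply: reach_step.
Qed.

Lemma reachP r k x y :
  reflect (exists p, [/\ path r x p, last x p = y & size p <= k]) (reach r k x y).
Proof.
apply: (iffP idP) => [|[p [rp <- le_pk]]]; last exact: reach_mono (reach_path rp).
elim: k y => [|k IH] y; first by move=> /eqP <-; exists [::].
case/orP=> [/IH[p [? ? ?]]|/existsP[z /andP[/IH[p [h1 h2 h3]] h4]]].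
  by exists p; split => //; apply: leqW.
by exists (rcons p y); rewrite rcons_path h1 h2 h4 last_rcons size_rcons.
Qed.

Lemma nd_le r k x y : reach r k x y -> nd r x y <= k.
Proof.
move=> h; rewrite /nd -(big_mkord predT (fun i => ~~ reach r i x y : nat)).
have [lekV|/ltnW leVk] := leqP k #|V|; last first.
  by apply: leq_trans leVk; rewrite -[leqRHS]subn0 -[leqRHS]muln1 -sum_nat_const_nat;
     apply: leq_sum => i _; case: reach.
rewrite (@big_cat_nat _ _ _ k) //= [X in _ + X]big_nat_cond [X in _ + X]big1 ?addn0.
  by rewrite -[leqRHS]subn0 -[leqRHS]muln1 -sum_nat_const_nat;
     apply: leq_sum => i _; case: reach.
by move=> i /andP[/andP[leki _] _]; rewrite (reach_mono leki h).
Qed.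

(** By monotonicity in k, failure at step d would make all summands of index at most d equal to 1;
    as d < |V| they all occur, and the sum would exceed d. *)
Lemma reach_nd r x y : nd r x y < #|V| -> reach r (nd r x y) x y.
Proof.
set d := nd r x y => ltdV; case: (boolP (reach r d x y)) => // nr.
have: d.+1 <= d; last by rewrite ltnn.
rewrite {2}/d /nd -(big_mkord predT (fun i => ~~ reach r i x y : nat)).
rewrite (@big_cat_nat _ _ _ d.+1) //=; apply: leq_trans (leq_addr _ _).
rewrite -[leqLHS]subn0 -[leqLHS]muln1 -sum_nat_const_nat big_nat_cond.
rewrite [leqRHS]big_nat_cond; apply: leq_sum => i /andP[/andP[_ leid] _].
by rewrite lt0b; apply: contra nr; apply: reach_mono.
Qed.

Lemma nd_connect r x y : (nd r x y < #|V|) = connect r x y.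
Proof.
apply/idP/connectP => [/reach_nd/reachP[p [? <- _]]|[p rp ->]]; first by exists p.
case/shortenP: rp => q rq uq _; apply: leq_ltn_trans (nd_le (reach_path rq)) _.
by rewrite -[_.+1]/(size (x :: q)) -(card_uniqP uq) max_card.
Qed.

Lemma reach_connect r k x y : reach r k x y -> connect r x y.
Proof. by case/reachP=> p [? <- _]; apply/connectP; exists p. Qed.

Lemma nd_lt r k x y : reach r k x y -> nd r x y < #|V|.
Proof. by rewrite nd_connect; apply: reach_connect. Qed.

Lemma nd_step r x y z : nd r x y < #|V| -> r y z -> nd r x z <= (nd r x y).+1.
Proof. by move=> /reach_nd h1 h2; apply/nd_le/(reach_step h1 h2). Qed.

Lemma nd_refl r x : nd r x x = 0.
Proof. by apply/eqP; rewrite -leqn0; apply: (@nd_le r 0); apply: reach_refl. Qed.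

Lemma nd_eq0 r x y : nd r x y < #|V| -> nd r x y = 0 -> x = y.
Proof. by move=> /reach_nd h e; rewrite e in h; apply/eqP. Qed.

Lemma nd_pred r x y : nd r x y < #|V| -> y != x ->
  exists2 z, r z y & (nd r x z).+1 = nd r x y.
Proof.
move=> dV yx; have := reach_nd dV; case e: (nd r x y) => [|k].
  by rewrite /= eq_sym (negbTE yx).
case/orP=> [/nd_le|/existsP[z /andP[h1 h2]]]; first by rewrite e ltnn.
exists z => //; apply/eqP; rewrite eqSS eqn_leq nd_le //=.
by rewrite -ltnS -e; apply: nd_step => //; apply: nd_lt h1.
Qed.

(** For a spanner walk that meets u, the two pieces bound the depths of its ends relative to u,
    which is what pays for a detour. *)
Lemma reach_avoid (G : sgraph V) k x y u : reach G k x y -> x != u -> y != u ->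
  reach (del_vertex G u) k x y \/
  exists k1 k2, [/\ k1 + k2 <= k, reach G k1 x u & reach G k2 u y].
Proof.
move=> + xu; elim: k y => [|k IH] y; first by left.
case/orP=> [/IH h /h [h1|[k1 [k2 [? ? ?]]]]|/existsP[z /andP[h1 h2]] yu].
- by left; apply: reach_mono h1.
- by right; exists k1, k2; split => //; apply: leqW.
have [zu|zu] := eqVneq z u.
  by right; exists k, 1; rewrite addn1 -zu; split => //; apply: reach1.
case: (IH _ h1 zu) => [h3|[k1 [k2 [? ? h4]]]].
  by left; apply: (reach_step h3); rewrite /= /del_adj /= zu yu.
by right; exists k1, k2.+1; rewrite addnS ltnS; split => //; apply: reach_step h2.
Qed.

Lemma reach_first_entry r (D : pred V) k x y : reach r k x y -> ~~ D x ->
  (~~ D y /\ reach [rel a b | [&& r a b, ~~ D a & ~~ D b]] k x y) \/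
  exists a b k1 k2, [/\ k1 + 1 + k2 <= k,
    reach [rel a b | [&& r a b, ~~ D a & ~~ D b]] k1 x a,
    [/\ ~~ D a, D b & r a b] & reach r k2 b y].
Proof.
move=> + xD; elim: k y => [|k IH] y; first by move=> /eqP <-; left; split => //=.
case/orP=> [/IH[[h1 h2]|[a [b [k1 [k2 [? ? ? ?]]]]]]|/existsP[z /andP[/IH h h2]]].
- by left; split => //; apply: reach_mono h2.
- by right; exists a, b, k1, k2; split => //; apply: leqW.
case: h => [[zD h1]|[a [b [k1 [k2 [? ? ? h4]]]]]]; last first.
  by right; exists a, b, k1, k2.+1; rewrite addnS ltnS; split => //; apply: reach_step h2.
case: (boolP (D y)) => yD.
  by right; exists z, y, k, 0; rewrite addn0 addn1; split => //=.
by left; split => //; apply: (reach_step h1); rewrite /= h2 zD.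
Qed.

End Walks.

(** * Passing between distances and walks *)

Section Distances.
Variables (V : finType) (R : realType).
Implicit Types (G H S : sgraph V).

Lemma dist_le G k x y : reach G k x y -> (dist R G x y <= k%:R%:E)%E.
Proof.
case/reachP=> p [pp lp le_pk]; apply: (@le_trans _ _ (size p)%:R%:E).
  by apply: ereal_inf_lbound; exists p.
by rewrite lee_fin ler_nat.
Qed.

Lemma dist_cases G x y :
  dist R G x y = +oo%E \/ exists2 k, reach G k x y & dist R G x y = k%:R%:E.
Proof.
case: (boolP (connect G x y)) => [cxy|ncxy].
  right; exists (nd G x y); first by apply: reach_nd; rewrite nd_connect.
  apply/eqP; rewrite eq_le dist_le ?reach_nd ?nd_connect //=.
  apply: le_ereal_inf_tmp => _ [p [pp lp] <-]; rewrite lee_fin ler_nat.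
  by apply: nd_le; rewrite -lp; apply: reach_path.
left; rewrite /dist [X in ereal_inf X](_ : _ = set0) ?ereal_inf0 //.
apply/seteqP; split => // _ [p [pp lp] _] /=.
by case/negP: ncxy; apply/connectP; exists p.
Qed.

Lemma dist_stretch (alpha beta : R) G H x y : (1 <= alpha)%R ->
  (dist R H x y <= alpha%:E * dist R G x y + beta%:E)%E <->
  (forall k, reach G k x y ->
     exists2 m, reach H m x y & (m%:R <= alpha * k%:R + beta)%R).
Proof.
move=> a1; have a0 : (0 < alpha)%R by exact: lt_le_trans a1.
split=> [le_d k rk|stretch].
  have: (dist R H x y <= (alpha * k%:R + beta)%:E)%E.
    apply: le_trans le_d _; rewrite EFinD EFinM leeD2r //.
    by rewrite lee_pmul2l ?lte_fin // dist_le.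
  case: (dist_cases H x y) => [->|[m rm ->]]; first by rewrite leye_eq.
  by rewrite lee_fin => ?; exists m.
case: (dist_cases G x y) => [->|[k /stretch[m rm lem] ->]].
  by rewrite gt0_muley ?lte_fin // addye // leey.
by apply: le_trans (dist_le rm) _; rewrite -EFinM -EFinD lee_fin.
Qed.

End Distances.

(** * The sparse subgraph *)

Section First.
Variable n : nat.
Implicit Types (Q : pred 'I_n) (r : rel 'I_n) (i j s t x y : 'I_n).

(** Ties are broken by the least index, which leaves at most one choice and is computable with one
    summation. *)
Definition first Q : pred 'I_n :=
  fun j => Q j && ~~ [exists z : 'I_n, (z < j) && Q z].

Lemma firstW Q j : first Q j -> Q j.
Proof. by case/andP. Qed.

Lemma first_inj Q i j : first Q i -> first Q j -> i = j.
Proof.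
move=> /andP[Qi /existsPn Hi] /andP[Qj /existsPn Hj].
case: (ltngtP i j) => [ij|ji|/val_inj //].
  by have := Hj i; rewrite ij Qi.
by have := Hi j; rewrite ji Qj.
Qed.

Lemma first_ex Q j : Q j -> exists i, first Q i.
Proof.
move=> Qj; case: (arg_minnP (fun i : 'I_n => i : nat) Qj) => i Qi min_i.
exists i; rewrite /first Qi; apply/existsPn => z; apply/negP => /andP[zi /min_i].
by rewrite leqNgt zi.
Qed.

Lemma sum_first Q : \sum_(j < n) first Q j <= 1.
Proof.
case: (boolP [exists j, first Q j]) => [/existsP[j Hj]|/existsPn H]; last first.
  by rewrite big1 // => j _; rewrite (negbTE (H j)).
rewrite (bigD1 j) //= big1 ?addn0; first exact: leq_b1.
by move=> i /eqP ij; case: (boolP (first Q i)) => // /first_inj /(_ Hj).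
Qed.

(** A relation from child to parent with at most one value, so that connectivity along it climbs the
    tree. *)
Definition bfs_parent r s : rel 'I_n :=
  fun t => first (fun x => r x t && ((nd r s x).+1 == nd r s t)).

Lemma bfs_parentW r s t x : bfs_parent r s t x -> r x t /\ (nd r s x).+1 = nd r s t.
Proof. by move=> /firstW /andP[? /eqP]. Qed.

Lemma bfs_parent_inj r s t x y : bfs_parent r s t x -> bfs_parent r s t y -> x = y.
Proof. exact: first_inj. Qed.

Lemma bfs_parent_ex r s t : nd r s t < n -> t != s -> exists x, bfs_parent r s t x.
Proof.
move=> dt ts; have [|x rx ex] := @nd_pred _ r s t _ ts; first by rewrite card_ord.
by apply: (@first_ex _ x); rewrite rx ex eqxx.
Qed.

End First.

(** * Heavy subtrees and the added edges *)

Section Construction.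
Variables (n : nat) (G S : sgraph 'I_n) (s : 'I_n).
Implicit Types (t u v w x y z : 'I_n).

Let d t := nd G s t.
Let P := bfs_parent G s.

Definition below u t : bool := connect P t u.
Definition sz u : nat := #|[pred t | below u t]|.
Definition heavy u v : bool := P v u && (sz u < sz v + sz v).
Definition inD u t : bool := [exists v, heavy u v && below v t].
Definition inO u t : bool := [&& below u t, t != u & ~~ inD u t].
Definition outer u : rel 'I_n :=
  [rel a b | [&& del_vertex G u a b, ~~ inD u a & ~~ inD u b]].
Let d1 u t := nd (del_vertex G u) s t.
Let d2 u t := nd (outer u) s t.

(* [entry u x z]: among the edges entering the heavy subtree of u, x -- z lies
   on a shortest path of G - u from s to the heavy child of u. *)
Definition entry u x z : bool :=
  [&& del_vertex G u x z, ~~ inD u x, inD u z, d2 u x < n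
    & [exists v, heavy u v && (d2 u x + d z == d1 u v + d u)]].
(** One edge is selected in two stages, source and then target, so that each stage is a choice of a
    single index. *)
Definition entry_src u : pred 'I_n := first (fun x => [exists z, entry u x z]).
Definition entry_dst u : pred 'I_n :=
  first (fun z => [exists x, entry_src u x && entry u x z]).
Definition ext u x y : bool :=
  inO u x && (bfs_parent (del_vertex G u) s x y || bfs_parent (outer u) s x y)
  || entry_src u x && entry_dst u y.

Definition out_adj : rel 'I_n := fun x y =>
  [|| S x y, P x y, P y x | [exists u, ext u x y || ext u y x]].

Lemma entry_edgeW u x z : entry_src u x -> entry_dst u z -> entry u x z.
Proof. by move=> sx /firstW /existsP[y /andP[/(first_inj sx) <-]]. Qed.

Lemma entry_edge_ex u x z : entry u x z ->
  exists x' z', entry_src u x' /\ entry_dst u z'.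
Proof.
move=> h; have [|x' hx'] := @first_ex _ (fun x => [exists z, entry u x z]) x.
  by apply/existsP; exists z.
have /existsP[z1 hz1] := firstW hx'.
have [|z' hz'] := @first_ex _ (fun z => [exists x, entry_src u x && entry u x z]) z1.
  by apply/existsP; exists x'; rewrite hz1 andbT.
by exists x', z'.
Qed.

Lemma outer_sub u : subrel (outer u) (del_vertex G u).
Proof. by move=> x y /and3P[]. Qed.

Lemma del_sub (K : sgraph 'I_n) u : subrel (del_vertex K u) K.
Proof. by move=> x y /and3P[]. Qed.

Lemma ext_sub u x y : ext u x y -> G x y.
Proof.
case/orP=> [/andP[_ /orP[/bfs_parentW[h _]|/bfs_parentW[h _]]]|/andP[h1 h2]].
- by rewrite adj_sym; apply: del_sub h.
- by rewrite adj_sym; apply: (del_sub (outer_sub h)).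
- by case/and5P: (entry_edgeW h1 h2) => /del_sub.
Qed.

Hypothesis SG : subrel S G.

Lemma out_adj_sub : subrel out_adj G.
Proof.
move=> x y
  /or4P[/SG //|/bfs_parentW[]|/bfs_parentW[]//|/existsP[u /orP[/ext_sub //|/ext_sub]]];
  by rewrite adj_sym.
Qed.

Lemma out_adj_sym : symmetric out_adj.
Proof.
move=> x y; rewrite /out_adj (adj_sym S); congr orb; rewrite orbCA; congr orb.
by congr orb; apply: eq_existsb => u; rewrite orbC.
Qed.

Lemma out_adj_irr : irreflexive out_adj.
Proof. by move=> x; apply/negP => /out_adj_sub; rewrite adj_irr. Qed.

Definition out_graph := SGraph out_adj_sym out_adj_irr.
Let H := out_graph.
Let Hd u := del_vertex H u.

(** * Walks along the breadth-first tree *)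

Lemma cardN : #|'I_n| = n. Proof. exact: card_ord. Qed.

Lemma d_reach k t : reach G k s t -> d t <= k /\ d t < n.
Proof.
by move=> h; split; [apply: nd_le h|rewrite -[X in _ < X]cardN; apply: nd_lt h].
Qed.

Lemma d_tri k x y : d x < n -> reach G k x y -> d y <= d x + k.
Proof.
move=> dx h; apply: nd_le; apply: reach_cat h; apply: reach_nd.
by rewrite cardN.
Qed.

Lemma d_s : d s = 0. Proof. exact: nd_refl. Qed.

Lemma PW t x : P t x -> G x t /\ (d x).+1 = d t.
Proof. exact: bfs_parentW. Qed.

Lemma below_d u t : below u t -> d u <= d t.
Proof.
case/connectP=> p; elim: p t => [|q p IH] t /=; first by move=> _ ->.
by case/andP=> /PW[_ <-] /IH h /h /leqW.
Qed.

Lemma Hd_sym u : symmetric (Hd u). Proof. exact: adj_sym. Qed.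

Lemma Hd_sub u : subrel (Hd u) (del_vertex G u).
Proof.
move=> x y; rewrite /Hd /= /del_adj /= => /and3P[-> -> /out_adj_sub ->].
by [].
Qed.

Lemma del_G_sym u : symmetric (del_vertex G u). Proof. exact: adj_sym. Qed.

Lemma Hd_tree u x y : P x y -> x != u -> y != u -> Hd u y x.
Proof. by move=> h xu yu; rewrite /Hd /= /del_adj /= xu yu /out_adj h !orbT. Qed.

Lemma Hd_S u : subrel (del_vertex S u) (Hd u).
Proof.
move=> x y; rewrite /Hd /= /del_adj /= => /and3P[-> -> h].
by rewrite /out_adj h.
Qed.

(** Each parent step lowers the depth by one, so the reversed path has the difference of depths as
    its length; it survives because it misses u. *)
Lemma tree_walk u t p : path P t p -> u \notin t :: p ->
  reach (Hd u) (d t - d (last t p)) (last t p) t.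
Proof.
elim: p t => [|q p IH] t /=; first by rewrite subnn /=.
case/andP=> tq qp; rewrite inE negb_or => /andP[ut uqp].
have := IH _ qp uqp; have [_ <-] := PW tq => h.
have : d (last q p) <= d q by apply: below_d; apply/connectP; exists p.
move=> le; rewrite subSn //; apply: reach_step h _; apply: Hd_tree => //.
  by rewrite eq_sym.
by move: uqp; rewrite inE negb_or eq_sym => /andP[].
Qed.

Lemma below_root t : d t < n -> below s t.
Proof.
move: {2}(d t) (erefl (d t)) => k; elim: k t => [|k IH] t e dt.
  have -> : t = s; last exact: connect0.
  by apply/esym/(@nd_eq0 _ G); rewrite ?cardN.
have ts : t != s by apply/eqP => ts; move: e; rewrite ts d_s.
have [q Pq] := bfs_parent_ex dt ts; have [_ e'] := PW Pq.
apply: connect_trans (connect1 Pq) _; apply: IH; first by lia.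
by apply: leq_ltn_trans dt; rewrite -e'.
Qed.

(** If the tree path from t to s met u, then t would be below u. *)
Lemma tree_out u t : d t < n -> ~~ below u t -> reach (Hd u) (d t) s t.
Proof.
move=> dt ut; have /connectP[p Pp es] := below_root dt.
have := @tree_walk u t p Pp; rewrite -es d_s subn0; apply.
apply: contra ut => /splitPl ut; case: ut Pp es => p1 p2 <-.
by rewrite cat_path => /andP[Pp1 _] _; apply/connectP; exists p1.
Qed.

Lemma tree_down u c t : below c t -> ~~ below c u ->
  reach (Hd u) (d t - d c) c t.
Proof.
move=> /connectP[p Pp es] cu; rewrite es; apply: tree_walk => //.
apply: contra cu => /splitPl ut; case: ut Pp es => p1 p2 e.
rewrite cat_path last_cat e => /andP[_ Pp2] ->.
by apply/connectP; exists p2.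
Qed.

(** Parents are unique, so the two upward paths from t agree until the shorter one stops; equal
    depths force equal ends. *)
Lemma below_inj v w t : below v t -> below w t -> d v = d w -> v = w.
Proof.
move=> /connectP[p]; elim: p t => [|q p IH] t /=.
  move=> _ -> /connectP[[|q p] //= /andP[/PW[_ e] Pp] ->] e2.
  have : d (last q p) <= d q by apply: below_d; apply/connectP; exists p.
  by rewrite -e2 -e ltnn.
case/andP=> Pq Pp ev /connectP[[|q' p'] /=].
  move=> _ -> e; move: e; have [_ <-] := PW Pq => e.
  have : d v <= d q by apply: below_d; apply/connectP; exists p.
  by rewrite e ltnn.
case/andP=> /(bfs_parent_inj Pq) <- Pp' ew; apply: (IH q) => //.
by apply/connectP; exists p'.
Qed.

(** * Subtree sizes and exact distances in H - u *)

Lemma sz_gt0 t : 0 < sz t.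
Proof. by apply/card_gt0P; exists t; rewrite inE /below connect0. Qed.

Lemma sz_child u v : P v u -> sz v <= sz u.
Proof.
move=> Pvu; apply: subset_leq_card; apply/fintype.subsetP => t; rewrite !inE => h.
exact: connect_trans h (connect1 Pvu).
Qed.

(** Distinct children have disjoint subtrees by [below_inj], so two heavy ones would together
    outnumber the subtree of u. *)
Lemma heavy_inj u v w : heavy u v -> heavy u w -> v = w.
Proof.
move=> /andP[Pv hv] /andP[Pw hw]; apply/eqP; apply: contraT => vw.
suff : sz v + sz w <= sz u by lia.
have dvw : d v = d w by have [_ <-] := PW Pv; have [_ <-] := PW Pw.
rewrite /sz -cardUI [X in _ + X](_ : _ = 0) ?addn0.
  apply: subset_leq_card; apply/fintype.subsetP => t; rewrite !inE => /orP[h|h].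
    exact: connect_trans h (connect1 Pv).
  exact: connect_trans h (connect1 Pw).
apply: eq_card0 => t; rewrite !inE; apply/negP => /andP[h1 h2].
by rewrite (below_inj h1 h2 dvw) eqxx in vw.
Qed.

Lemma inD_d u t : inD u t -> d u < d t.
Proof. by case/existsP=> v /andP[/andP[/PW[_ e] _] /below_d]; rewrite -e. Qed.

Lemma inD_below u v t : heavy u v -> inD u t -> below v t.
Proof. by move=> hv /existsP[w /andP[/(heavy_inj hv) <-]]. Qed.

Lemma heavy_not_above u v : heavy u v -> ~~ below v u.
Proof.
move=> /andP[/PW[_ e] _]; apply/negP => /below_d.
by rewrite -e ltnn.
Qed.

Lemma inD_s u : ~~ inD u s.
Proof. by apply/negP => /inD_d; rewrite d_s ltn0. Qed.

Lemma below_s u : below u s -> u = s.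
Proof.
move=> h; have := below_d h; rewrite d_s leqn0 => /eqP e.
apply/esym/(@nd_eq0 _ G) => //; rewrite -[nd _ _ _]/(d u) e cardN.
exact: leq_ltn_trans (leq0n s) (ltn_ord s).
Qed.

(** Induction on the length: outside the subtree of u the tree path is already shortest, and for x
    in O the last edge of a shortest path in G - u - D was added to H. *)
Lemma outer_exact u x k : u != s -> x != u -> ~~ inD u x ->
  reach (outer u) k s x -> reach (Hd u) k s x.
Proof.
move=> us; elim/ltn_ind: k x => k IH x xu xD h.
have [dxk dxn] := d_reach (reach_sub (fun a b h => del_sub (outer_sub h)) h).
case: (boolP (below u x)) => ux; last exact: reach_mono (tree_out dxn ux).
have xs : x != s by apply: contraNneq us => xs; apply/eqP/below_s; rewrite -xs.
have d2n : d2 u x < n by rewrite -[X in _ < X]cardN; apply: nd_lt h.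
have [y py] := bfs_parent_ex d2n xs; have [/and3P[yx yD _] e] := bfs_parentW py.
have lek : d2 u x <= k := nd_le h.
have yu : y != u by case/and3P: yx.
have ey : nd (outer u) s y < k by rewrite -(ltn_add2r 1) !addn1 e.
apply: (@reach_mono _ _ (nd (outer u) s y).+1) => //.
apply: (@reach_step _ _ _ _ y).
  apply: IH => //; apply: reach_nd; rewrite cardN.
  by apply: ltn_trans d2n; rewrite /d2 -e.
rewrite /Hd /= /del_adj /= xu yu /out_adj /=.
have -> : [exists u0, ext u0 y x || ext u0 x y]; last by rewrite !orbT.
by apply/existsP; exists u; rewrite /ext /inO ux xu xD py /= !orbT.
Qed.

(** Enter D at z, then climb the tree from z to v; this avoids u, which is not below v. *)
Lemma heavy_walk u v x z k : heavy u v -> del_vertex G u x z -> inD u z ->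
  reach (outer u) k s x ->
  reach (del_vertex G u) (k + 1 + (d z - d v)) s v.
Proof.
move=> hv xz zD h; have vz := inD_below hv zD.
apply: reach_cat (reach_cat (reach_sub (@outer_sub u) h) (reach1 xz)) _.
apply: (reach_sub (@Hd_sub u)); apply: (reach_sym (@Hd_sym u)).
exact: tree_down vz (heavy_not_above hv).
Qed.

(** A shortest walk of G - u from s to v first enters D by an edge satisfying [entry], so a selected
    edge exists. All such edges give routes of the same length, hence H - u attains the distance to
    v itself. *)
Lemma heavy_exact u v x z k : u != s -> heavy u v -> del_vertex G u x z ->
  inD u z -> reach (outer u) k s x ->
  reach (Hd u) (k + 1 + (d z - d v)) s v.
Proof.
move=> us hv xz zD h; have w := heavy_walk hv xz zD h.
apply: reach_mono (nd_le w) _.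
have d1v := nd_lt w; have rv := reach_nd d1v.
have vD : inD u v by apply/existsP; exists v; rewrite hv /below connect0.
have [|[x0 [z0 [l1 [l2 [le h1 [xD z0D xz0] h2]]]]]] :=
  reach_first_entry rv (inD_s u); first by case; rewrite vD.
have ev : (d u).+1 = d v by case/andP: hv => /PW[].
have vz0 := inD_below hv z0D.
have d2x : d2 u x0 < n by rewrite -[X in _ < X]cardN; apply: nd_lt h1.
have r2 : reach (outer u) (d2 u x0) s x0 by apply: reach_nd; rewrite cardN.
have le1 : d2 u x0 <= l1 := nd_le h1.
have ge1 : nd (del_vertex G u) s v <= d2 u x0 + 1 + (d z0 - d v).
  exact: nd_le (heavy_walk hv xz0 z0D r2).
have dvz := below_d vz0.
have dvn : d v < n.
  by have [] := d_reach (reach_sub (@del_sub G u) rv).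
have le2 : d z0 <= d v + l2.
  apply: d_tri dvn _; apply: (reach_sub (@del_sub G u)).
  exact: (reach_sym (@del_G_sym u)).
(* As d z0 <= d v + l2, climbing from z0 to v is no longer than the rest of the shortest walk, so
   the route through x0 and z0 is shortest; with d v = d u + 1 this is the equation in [entry]. *)
have /entry_edge_ex[x' [z' [hx' hz']]] : entry u x0 z0.
  apply/and5P; split=> //; apply/existsP; exists v; rewrite hv /=.
  apply/eqP; rewrite /d1; move: le le1 le2 ge1 dvz ev; clear.
  move: (nd (del_vertex G u) s v) (d2 u x0) (d z0) (d v) (d u) => *; lia.
have /and5P[xz' xD' zD' d2x' /existsP[v' /andP[/(heavy_inj hv) <- /eqP e']]] :=
  entry_edgeW hx' hz'.
have vz' := inD_below hv zD'; have := below_d vz'; move: e'; rewrite /d1 => e' dvz'.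
have xu' : x' != u by case/and3P: xz'.
have zu' : z' != u by case/and3P: xz'.
have -> : nd (del_vertex G u) s v = d2 u x' + 1 + (d z' - d v).
  move: e' ev dvz'; clear.
  move: (nd (del_vertex G u) s v) (d2 u x') (d z') (d v) (d u) => *; lia.
apply: (@reach_cat _ _ _ _ _ z'); first apply: (@reach_cat _ _ _ _ _ x').
- by apply: outer_exact => //; apply: reach_nd; rewrite cardN.
- apply: reach1; rewrite /Hd /= /del_adj /= xu' zu' /out_adj /=.
  have -> : [exists u0, ext u0 x' z' || ext u0 z' x']; last by rewrite !orbT.
  by apply/existsP; exists u; rewrite /ext hx' hz' !orbT.
- apply: (reach_sym (@Hd_sym u)).
  exact: tree_down vz' (heavy_not_above hv).
Qed.

(** * Stretch after a failure *)

Section Stretch.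
Variables (R : realType) (alpha beta : R).
Hypotheses (alpha_ge1 : (1 <= alpha)%R) (beta_ge0 : (0 <= beta)%R).
Hypothesis S_stretch : forall x y k, reach G k x y ->
  exists2 m, reach S m x y & (m%:R <= alpha * k%:R + beta)%R.

(* Let x -- z be the edge through which the walk first enters the heavy subtree.
   If the spanner walk from x to t meets u, then it is at least as long as the
   exact detour from x to the heavy child of u followed by the tree path to t. *)
Lemma stretch_heavy u t k : u != s -> inD u t ->
  reach (del_vertex G u) k s t ->
  exists2 m, reach (Hd u) m s t & (m%:R <= alpha * k%:R + beta)%R.
Proof.
move=> us tD h.
have [|[x [z [k1 [k2 [le h1 [xD zD xz] h2]]]]]] := reach_first_entry h (inD_s u).
  by case; rewrite tD.
have [xu zu] : x != u /\ z != u by case/and3P: xz.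
have rx := outer_exact us xu xD h1.
have tu : t != u by apply/eqP => tu; move: (inD_d tD); rewrite tu ltnn.
have [|m rm lem] := S_stretch (x := x) (y := t) (k := 1 + k2).
  apply: (reach_sub (@del_sub G u)); exact: reach_cat (reach1 xz) h2.
(* The k1 steps before x are preserved exactly; the stretch and the single beta are spent on the
   remaining 1 + k2 steps. *)
have bound : (k1%:R + m%:R <= alpha * k%:R + beta :> R)%R.
  have : (alpha * (k1 + (1 + k2))%:R <= alpha * k%:R)%R.
    by rewrite ler_pM2l ?ler_nat ?addnA // (lt_le_trans _ alpha_ge1).
  have : (k1%:R <= alpha * k1%:R)%R by rewrite ler_peMl.
  by rewrite (natrD _ k1) mulrDr; lra.
have [rm'|[m1 [m2 [lem12 r1 r2]]]] := reach_avoid rm xu tu.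
  exists (k1 + m); last by rewrite natrD.
  exact: reach_cat rx (reach_sub (@Hd_S u) rm').
have /existsP[v /andP[hv vt]] := tD.
have rv := heavy_exact us hv xz zD h1.
exists (k1 + 1 + (d z - d v) + (d t - d v)).
  exact: reach_cat rv (tree_down vt (heavy_not_above hv)).
(* Since d v = d u + 1, the part from z to v costs at most m1 and the part from v to t at most m2 -
   1; the unit saved pays for the edge from x to z. *)
apply: le_trans bound; rewrite -natrD ler_nat.
have ev : (d u).+1 = d v by case/andP: hv => /PW[].
have dxn : d x < n.
  by have [] := d_reach (reach_sub (fun a b h => del_sub (outer_sub h)) h1).
have r1G := reach_sub SG r1; have r2G := reach_sub SG r2.
have xzG := @del_sub G u _ _ xz.
have dun : d u < n.
  have [] // := d_reach (reach_cat (reach_nd (_ : nd G s x < #|'I_n|)) r1G).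
  by rewrite cardN.
have e1 : d t <= d u + m2 := d_tri dun r2G.
have e2 : d z <= d u + (m1 + 1).
  apply: d_tri dun _; apply: reach_cat (reach1 xzG).
  exact: reach_sym (adj_sym G) r1G.
have := below_d vt; have := below_d (inD_below hv zD); move: e1 e2 ev lem12; clear.
by move: (d z) (d v) (d u) (d t) => *; lia.
Qed.

(** Outside the subtree of u the tree path is exact. For t in O the last edge of a shortest path of
    G - u lies in H, so the bound for its predecessor extends by one edge, at a cost of 1 <=
    alpha. *)
Lemma stretch_all u t k : u != s -> t != u ->
  reach (del_vertex G u) k s t ->
  exists2 m, reach (Hd u) m s t & (m%:R <= alpha * k%:R + beta)%R.
Proof.
move=> us; elim/ltn_ind: k t => k IH t tu h.
case: (boolP (inD u t)) => tD; first exact: stretch_heavy.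
have [dtk dtn] := d_reach (reach_sub (@del_sub G u) h).
case: (boolP (below u t)) => ut; last first.
  exists (d t); first exact: tree_out.
  have : ((d t)%:R <= k%:R :> R)%R by rewrite ler_nat.
  have : (k%:R <= alpha * k%:R)%R by rewrite ler_peMl.
  by move: beta_ge0; lra.
have ts : t != s by apply: contraNneq us => ts; apply/eqP/below_s; rewrite -ts.
have d1n : d1 u t < n by rewrite -[X in _ < X]cardN; apply: nd_lt h.
have [y py] := bfs_parent_ex d1n ts; have [yt e] := bfs_parentW py.
have lek : d1 u t <= k := nd_le h.
have yu : y != u by case/and3P: yt.
have ey : nd (del_vertex G u) s y < k by rewrite -(ltn_add2r 1) !addn1 e.
have [|m rm lem] := IH _ ey y yu.
  apply: reach_nd; rewrite cardN.
  by apply: ltn_trans d1n; rewrite /d1 -e.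
exists m.+1.
  apply: reach_step rm _; rewrite /Hd /= /del_adj /= tu yu /out_adj /=.
  have -> : [exists u0, ext u0 y t || ext u0 t y]; last by rewrite !orbT.
  by apply/existsP; exists u; rewrite /ext /inO ut tu tD py /= !orbT.
have : (alpha * (nd (del_vertex G u) s y).+1%:R <= alpha * k%:R)%R.
  by rewrite ler_pM2l ?ler_nat // (lt_le_trans _ alpha_ge1).
by rewrite -!natr1 mulrDr; move: alpha_ge1 lem; lra.
Qed.

End Stretch.

Lemma out_graph_vabfs (R : realType) (alpha beta : R) :
  (1 <= alpha)%R -> (0 <= beta)%R -> spanner alpha beta G S ->
  vabfs alpha beta G s out_graph.
Proof.
move=> a1 b0 [_ stretch]; split; first exact: out_adj_sub.
move=> u t us tu; apply/dist_stretch => // k; apply: stretch_all => // x y l.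
by move: l; apply/dist_stretch.
Qed.

(** * Counting the edges *)

Lemma inO_parent u t q : P t q -> inO u t ->
  u = q /\ sz t + sz t <= sz q \/ u != q /\ inO u q.
Proof.
move=> Pq /and3P[/connectP[[|q' p] /= Pp eu] tu tD].
  by rewrite eu eqxx in tu.
case/andP: Pp => /(bfs_parent_inj Pq) eq Pp; move: Pp eu; rewrite -eq => Pp eu.
have [uq|uq] := eqVneq u q; [left|right]; split=> //.
  rewrite leqNgt; apply: contra tD => hs; apply/existsP; exists t.
  by rewrite uq /heavy Pq hs /below connect0.
apply/and3P; split; [by apply/connectP; exists p|by rewrite eq_sym|].
apply: contra tD => /existsP[v /andP[hv vq]]; apply/existsP; exists v.
by rewrite hv; apply: connect_trans vq; apply: connect1.
Qed.

(** Induction down the tree: from the parent q to t only the set O of q can be gained, and then t is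
    a light child, so the factor 2 is paid for by 2 [sz t] <= [sz q]. *)
Lemma light_count t : 2 ^ (\sum_u inO u t) * sz t <= n.
Proof.
move: {2}(d t) (erefl (d t)) => k; elim: k t => [|k IH] t e.
all: have szn : sz t <= n by rewrite -[X in _ <= X]cardN max_card.
all: have [/existsP[q Pq]|/existsPn noP] := boolP [exists q, P t q].
(* A vertex without a parent has no proper ancestor, so it lies in no set O. *)
all: try by rewrite big1 ?expn0 ?mul1n // => u _;
  case: (boolP (inO u t)) => // /and3P[/connectP[[|q p] /= Pp eu] tu _];
  [rewrite eu eqxx in tu | case/andP: Pp; rewrite (negbTE (noP q))].
  by have [_] := PW Pq; rewrite e.
have {}IH := IH q; have [_ eq] := PW Pq.
have {}IH : 2 ^ (\sum_u inO u q) * sz q <= n by apply: IH; lia.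
apply: leq_trans IH; rewrite (bigD1 q) //=.
have le : \sum_(u | u != q) inO u t <= \sum_u inO u q.
  rewrite [leqRHS](bigID (fun u => u != q)) /=; apply: leq_trans (leq_addr _ _).
  apply: leq_sum => u uq; case: (boolP (inO u t)) => // /(inO_parent Pq).
  by case=> [[uq' _]|[_ ->]] //; rewrite uq' eqxx in uq.
have szq := sz_child Pq.
case: (boolP (inO q t)) => [/(inO_parent Pq)[[_ h]|[]]|_]; last 2 first.
- by rewrite eqxx.
- by rewrite add0n leq_mul // leq_pexp2l.
rewrite expnD expn1 mulnAC mulnC leq_mul ?leq_pexp2l //.
by rewrite mul2n -addnn.
Qed.

(** Besides S there are at most one parent edge per vertex and one entry edge per failing vertex,
    which make 2 n, and at most two last edges for each u and each t in O. *)
Lemma nb_edges_out_graph :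
  nb_edges out_graph <= nb_edges S + (2 * n + 2 * \sum_t \sum_u inO u t).
Proof.
pose E x y := P x y || [exists u, ext u x y].
have sub : edges out_graph \subset
    edges S :|: [set [set p.1; p.2] | p in [set p : 'I_n * 'I_n | E p.1 p.2]].
  apply/fintype.subsetP => A; rewrite !inE => /existsP[x /existsP[y /andP[/= h /eqP ->]]].
  have hE (a b : 'I_n) : E a b -> [set a; b] \in
     [set [set p.1; p.2] | p in [set p : 'I_n * 'I_n | E p.1 p.2]].
    by move=> Eab; apply/imsetP; exists (a, b); rewrite ?inE.
  case/or4P: h => [h|h|h|/existsP[u /orP[h|h]]].
  - apply/orP; left; apply/existsP; exists x; apply/existsP; exists y.
    by rewrite h eqxx.
  - by rewrite hE ?orbT // /E h.
  - by rewrite finset.setUC hE ?orbT // /E h.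
  - by rewrite hE ?orbT // /E; apply/orP; right; apply/existsP; exists u.
  - by rewrite finset.setUC hE ?orbT // /E; apply/orP; right; apply/existsP; exists u.
apply: leq_trans (subset_leq_card sub) _.
apply: leq_trans (leq_card_setU _ _) _; rewrite leq_add2l.
apply: leq_trans (leq_imset_card _ _) _.
have -> : #|[set p : 'I_n * 'I_n | E p.1 p.2]| = \sum_x \sum_y E x y.
  rewrite pair_big /= -sum1dep_card big_mkcond /=.
  by apply: eq_bigr => p _; case: (E _ _).
have leE x y : E x y <= P x y + \sum_u
    (inO u x * (bfs_parent (del_vertex G u) s x y + bfs_parent (outer u) s x y)
      + entry_src u x * entry_dst u y).
  rewrite /E; case: (P x y) => //=; rewrite add0n.
  case: (boolP [exists u, _]) => //= /existsP[u].
  rewrite (bigD1 u) //= /ext => h; apply: leq_trans (leq_addr _ _).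
  move: h; case: (inO u x); case: (bfs_parent (del_vertex G u) s x y);
    case: (bfs_parent (outer u) s x y); case: (entry_src u x); by case: (entry_dst u y).
apply: (@leq_trans (\sum_x \sum_y (P x y + \sum_u
    (inO u x * (bfs_parent (del_vertex G u) s x y + bfs_parent (outer u) s x y)
      + entry_src u x * entry_dst u y)))).
  by apply: leq_sum => x _; apply: leq_sum => y _.
under eq_bigr do rewrite big_split /=.
rewrite big_split /= mul2n -addnn -addnA; apply: leq_add.
  rewrite -[leqRHS](mul1n n) -[X in _ <= 1 * X]cardN mulnC -sum_nat_const.
  by apply: leq_sum => x _; apply: sum_first.
under eq_bigr do rewrite exchange_big /=; rewrite exchange_big /=.
rewrite [X in _ + 2 * X]exchange_big /=.
have en : n = \sum_(u < n) 1 by rewrite sum_nat_const card_ord muln1.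
rewrite [X in _ <= X + _]en big_distrr /= -big_split /=; apply: leq_sum => u _.
rewrite addnC.
under eq_bigr do rewrite big_split /=.
rewrite big_split /=; apply: leq_add; last first.
  (* The double sum over the two ends factors, and each factor is at most 1. *)
  rewrite -big_distrlr /=; apply: (@leq_trans (1 * 1)) => //.
  by apply: leq_mul; apply: sum_first.
rewrite big_distrr /=; apply: leq_sum => x _.
rewrite -big_distrr /= big_split /= mulnC leq_mul2r; apply/orP; right.
by apply: (@leq_trans (1 + 1)) => //; apply: leq_add; apply: sum_first.
Qed.

(** With X = n ln n and L the total size of the sets O, both n and L are at most X / ln 2, so 2 n +
    2 L <= 4 X / ln 2. The bound on n needs n >= 2; a single vertex has no edges. *)
Lemma nb_edges_out_graph_log (R : realType) :
  ((nb_edges out_graph)%:R <=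
    (1 + 4 / ln 2) * ((nb_edges S)%:R + n%:R * ln n%:R) :> R)%R.
Proof.
have ln2 : (0 < ln 2 :> R)%R by rewrite ln_gt0 // ltr1n.
have n0 : 0 < n := leq_ltn_trans (leq0n s) (ltn_ord s).
have lnn : (0 <= ln n%:R :> R)%R by rewrite ln_ge0 // ler1n.
have [n1|n1] := leqP n 1.
  suff -> : nb_edges out_graph = 0.
    apply: mulr_ge0; first by rewrite addr_ge0 // divr_ge0 // ltW.
    by rewrite addr_ge0 // mulr_ge0.
  apply: eq_card0 => A; rewrite !inE; apply/idP => /existsP[x /existsP[y /andP[h _]]].
  suff xy : x = y by rewrite xy adj_irr in h.
  by apply: ord_inj; move: (leq_trans (ltn_ord x) n1) (leq_trans (ltn_ord y) n1);
    rewrite !ltnS !leqn0 => /eqP -> /eqP ->.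
have le_ln m : 2 ^ m <= n -> (m%:R * ln 2 <= ln n%:R :> R)%R.
  move=> le; rewrite mulrC mulr_natr -lnXn // ler_ln ?posrE ?exprn_gt0 ?ltr0n //.
  by rewrite -natrX ler_nat.
have leL : ((\sum_t \sum_u inO u t)%:R * ln 2 <= n%:R * ln n%:R :> R)%R.
  rewrite natr_sum mulr_suml.
  apply: (@le_trans _ _ (\sum_(t < n) ln n%:R)%R).
    apply: ler_sum => t _; apply: le_ln; apply: leq_trans (light_count t).
    by rewrite leq_pmulr // sz_gt0.
  by rewrite sumr_const card_ord mulr_natl.
have le1 : (n%:R * ln 2 <= n%:R * ln n%:R :> R)%R.
  by rewrite ler_wpM2l // ler_ln ?posrE ?ltr0n // ler_nat.
have := nb_edges_out_graph; rewrite -(ler_nat R) natrD natrD !natrM => le.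
apply: le_trans le _; set L := (((\sum_t \sum_u inO u t)%N)%:R)%R in leL *.
set X := (n%:R * ln n%:R)%R in leL le1 *.
have X0 : (0 <= X)%R by rewrite mulr_ge0.
have eL : (L <= X / ln 2)%R by rewrite ler_pdivlMr.
have en : (n%:R <= X / ln 2)%R by rewrite ler_pdivlMr.
have S0 : (0 <= (nb_edges S)%:R / ln 2 :> R)%R by rewrite divr_ge0 // ltW.
have -> : ((1 + 4 / ln 2) * ((nb_edges S)%:R + X) =
    (nb_edges S)%:R + X + 4 * ((nb_edges S)%:R / ln 2) + 4 * (X / ln 2))%R by ring.
lra.
Qed.

End Construction.

(** * Running times and memory contents of programs *)

Local Notation eval := Defs.eval.

Fixpoint writes (x : nat) (c : cmd) : bool :=
  match c with
  | Skip => false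
  | Assign y _ => x == y
  | Store _ _ _ _ => false
  | Seq c1 c2 => writes x c1 || writes x c2
  | If _ c1 c2 => writes x c1 || writes x c2
  | While _ c1 => writes x c1
  end.

Lemma exec_writes x c st t st' :
  exec c st t st' -> ~~ writes x c -> vars st' x = vars st x.
Proof.
elim=> //=.
- by move=> {}st y e /negbTE ->.
- by move=> c1 c2 ? ? ? ? ? _ IH1 _ IH2; rewrite negb_or => /andP[/IH1 <- /IH2].
- by move=> e c1 c2 ? ? ? _ _ IH; rewrite negb_or => /andP[/IH].
- by move=> e c1 c2 ? ? ? _ _ IH; rewrite negb_or => /andP[_ /IH].
- by move=> e c1 ? ? ? ? ? _ _ IH1 _ IH2 w; rewrite IH2 // IH1.
Qed.

(** A syntactic check ensuring that the value of e is unaffected while array b is being filled. *)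
Fixpoint reads_within (xs : seq nat) (b : nat) (e : expr) : bool :=
  match e with
  | Cst _ => true
  | Var x => x \in xs
  | Cell a e1 e2 => [&& a != b, reads_within xs b e1 & reads_within xs b e2]
  | Plus e1 e2 | Minus e1 e2 => reads_within xs b e1 && reads_within xs b e2
  end.

Lemma eval_agree xs b e st st' : reads_within xs b e ->
  (forall x, x \in xs -> vars st x = vars st' x) ->
  (forall a i j, a != b -> arrs st a i j = arrs st' a i j) ->
  eval st e = eval st' e.
Proof.
move=> + hv ha; elim: e => //= [a e1 IH1 e2 IH2|e1 IH1 e2 IH2|e1 IH1 e2 IH2].
- by case/and3P=> ab /IH1 -> /IH2 ->; apply: ha.
- by case/andP=> /IH1 -> /IH2 ->.
- by case/andP=> /IH1 -> /IH2 ->.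
Qed.

(** * Bounded loops *)

Definition For (x : nat) (c : cmd) : cmd :=
  Seq (Assign x (Cst 0))
      (While (Minus (Var 0) (Var x)) (Seq c (Assign x (Plus (Var x) (Cst 1))))).

(** Each round adds a test and an increment to the body, hence T + 2; the final 2 is the initial
    assignment and the failing test. *)
Lemma exec_For x c n T (I : nat -> state -> Prop) st :
  x != 0 -> ~~ writes x c -> ~~ writes 0 c -> vars st 0 = n ->
  (forall i st, i < n -> vars st 0 = n -> vars st x = i -> I i st ->
     exists t st', [/\ exec c st t st', t <= T & I i.+1 (set_var st' x i.+1)]) ->
  I 0 (set_var st x 0) ->
  exists t st', [/\ exec (For x c) st t st', t <= n * (T + 2) + 2 & I n st'].
Proof.
move=> x0 wx w0 vn body I0.
suff loop j i st1 : i + j = n -> vars st1 0 = n -> vars st1 x = i -> I i st1 ->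
    exists t st', [/\ exec (While (Minus (Var 0) (Var x))
        (Seq c (Assign x (Plus (Var x) (Cst 1))))) st1 t st',
      t <= j * (T + 2) + 1 & I n st'].
  have [||t [st' [h1 h2 h3]]] := loop n 0 (set_var st x 0) (add0n _) _ _ I0 => //=.
  - by rewrite eq_sym (negbTE x0).
  - by rewrite eqxx.
  by exists (1 + t), st'; split => //; [apply: exec_Seq h1; apply: exec_Assign|lia].
elim: j i st1 => [|j IH] i st1 ijn v0 vx Ii.
  exists 1, st1; split=> //; last by rewrite -ijn addn0.
  by apply: exec_WhileF; rewrite /= v0 vx -ijn addn0 subnn.
have [|t [st2 [h1 h2 h3]]] := body i st1 _ v0 vx Ii; first by lia.
have v0' : vars st2 0 = n by rewrite (exec_writes h1).
have vx' : vars st2 x = i by rewrite (exec_writes h1).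
have [|||t' [st3 [g1 g2 g3]]] := IH i.+1 (set_var st2 x i.+1) _ _ _ h3.
- by lia.
- by rewrite /= eq_sym (negbTE x0).
- by rewrite /= eqxx.
exists (t + 1 + t').+1, st3; split=> //; last by lia.
apply: exec_WhileT g1; first by rewrite /= v0 vx -lt0n; lia.
apply: exec_Seq h1 _; have := exec_Assign st2 x (Plus (Var x) (Cst 1)).
by rewrite /= vx' addn1.
Qed.

(** * Filling arrays cell by cell *)

Definition memory := nat -> nat -> nat -> nat.

Definition upd (n : nat) (m : memory) (a : nat) (f : nat -> nat -> nat) : memory :=
  fun b i j => if (b == a) && ((i < n) && (j < n)) then f i j else m b i j.

(* Variable 2 holds the failing vertex, 3 and 4 the indices of the cell being
   computed, 5 a summation index, 6 a round counter (never read by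
   expressions), and 7 the value of the sum over variable 5. *)
Definition env (n s u i j z acc : nat) (x : nat) : nat :=
  nth 0 [:: n; s; u; i; j; z; 0; acc] x.

(** The summation loop leaves n in variable 5 and the sum in variable 7; the 0 given to [es] for
    variable 7 is a dummy. *)
Definition fillf n s u (m : memory) (es e : expr) (i j : nat) : nat :=
  eval (State (env n s u i j n
    (\sum_(z < n) eval (State (env n s u i j z 0) m) es)) m) e.

(** Variables from 3 on are scratch and stay unconstrained; arrays are compared pointwise. *)
Definition repr n s u (m : memory) (st : state) : Prop :=
  [/\ vars st 0 = n, vars st 1 = s, vars st 2 = u
    & forall a i j, arrs st a i j = m a i j].

Definition Fill (a : nat) (es e : expr) : cmd :=
  For 3 (For 4 (Seq (Assign 7 (Cst 0))
    (Seq (For 5 (Assign 7 (Plus (Var 7) es))) (Store a (Var 3) (Var 4) e)))).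

(* The detour through array 3 allows [es] and [e] to read the array [a]. *)
Definition Update (a : nat) (es e : expr) : cmd :=
  Seq (Fill 3 es e) (Fill a (Cst 0) (Cell 3 (Var 3) (Var 4))).

Definition index_vars := [:: 0; 1; 2; 3; 4; 5].

Lemma exec_Fill a es e n s u m st : reads_within index_vars a es ->
  reads_within (7 :: index_vars) a e ->
  repr n s u m st ->
  exists t st', [/\ exec (Fill a es e) st t st',
    t <= n * (n * (n * 3 + 4 + 2) + 2 + 2) + 2
    & repr n s u (upd n m a (fillf n s u m es e)) st'].
Proof.
move=> wes we [v0 v1 v2 ha].
set f := fillf n s u m es e.
pose g i j z := eval (State (env n s u i j z 0) m) es.
(* Loop invariant: the cells before (i, j) in row-major order hold their final values. *)
pose J i j (st : state) := [/\ vars st 0 = n, vars st 1 = s, vars st 2 = u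
  & forall b k l, arrs st b k l =
      if [&& b == a, (k < n) && (l < n) & (k < i) || (k == i) && (l < j)]
      then f k l else m b k l].
have J0 st0 : repr n s u m st0 -> J 0 0 st0.
  case=> ? ? ? h; split=> // b k l.
  by rewrite h !ltn0 !andbF.
have Jmono i st0 st1 : J i n st0 -> arrs st1 = arrs st0 ->
    vars st1 0 = vars st0 0 -> vars st1 1 = vars st0 1 ->
    vars st1 2 = vars st0 2 -> J i.+1 0 st1.
  case=> ? ? ? h e0 e1 e2 e3; split; rewrite ?e1 ?e2 ?e3 // => b k l.
  rewrite e0 h ltn0 andbF orbF ltnS [k <= i]leq_eqVlt.
  by case: (ltnP l n); rewrite ?andbF //= ?andbT ?[(k == i) || _]orbC.
have [|||||t [st' [h1 h2 h3]]] := @exec_For 3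
    (For 4 (Seq (Assign 7 (Cst 0))
    (Seq (For 5 (Assign 7 (Plus (Var 7) es))) (Store a (Var 3) (Var 4) e))))
    n (n * (n * 3 + 4 + 2) + 2) (fun i st => J i 0 st) st _ _ _ v0 => //.
- move=> i st0 lin w0 w3 Ji.
  have [|||||t [st' [h1 h2 [h3 h4]]]] := @exec_For 4
    (Seq (Assign 7 (Cst 0))
    (Seq (For 5 (Assign 7 (Plus (Var 7) es))) (Store a (Var 3) (Var 4) e)))
    n (n * 3 + 4) (fun j st => J i j st /\ vars st 3 = i) st0 _ _ _ w0 => //.
  + move=> j st1 ljn x0 x4 [Jij x3].
    have [|||||t [st' [h1 h2 [h3 h4 h5 h7 h6]]]] := @exec_For 5
      (Assign 7 (Plus (Var 7) es)) n 1
      (fun z st => [/\ J i j st, vars st 3 = i, vars st 4 = j,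
         vars st 5 = z & vars st 7 = \sum_(0 <= y < z) g i j y])
      (set_var st1 7 0) _ _ _ x0 => //.
    * move=> z st2 lzn y0 y5 [Jz y3 y4 _ y7].
      exists 1, (set_var st2 7 (eval st2 (Plus (Var 7) es))).
      split=> //; first exact: exec_Assign.
      split=> //=; rewrite big_nat_recr //= y7; congr (_ + _).
      case: Jz => z0 z1 z2 z3; apply: (eval_agree wes) => [x|b k l ba] /=.
        by rewrite !inE => /or4P[/eqP->|/eqP->|/eqP->|/or3P[/eqP->|/eqP->|/eqP->]].
      by rewrite z3 (negbTE ba).
    * by split=> //=; rewrite big_geq.
    exists (1 + (t + 1)), (set_cell st' a i j (f i j)); split; last first.
    * case: h3 => z0 z1 z2 z3; split=> //; split=> //= b k l; rewrite z3.
      have [-> /=|] := eqVneq b a; last by [].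
      have [->|ki] := eqVneq k i; have [->|lj] := eqVneq l j => //=.
      - by rewrite lin ljn ltnn ltnSn.
      - by rewrite lin ltnn /= ltnS [l <= j]leq_eqVlt (negbTE lj).
    * by lia.
    apply: exec_Seq; first exact: (exec_Assign st1 7 (Cst 0)).
    apply: exec_Seq h1 _; have := exec_Store st' a (Var 3) (Var 4) e.
    rewrite /= h4 h5; congr (exec _ _ _ (set_cell _ _ _ _ _)).
    case: h3 => z0 z1 z2 z3; rewrite /f /fillf.
    apply: (eval_agree we) => [x|b k l ba] /=; last by rewrite z3 (negbTE ba).
    rewrite /= !inE => /orP[/eqP ->|]; first by rewrite h6 big_mkord.
    by move=> /or4P[/eqP->|/eqP->|/eqP->|/or3P[/eqP->|/eqP->|/eqP->]].
  + by exists t, st'; split=> //; apply: Jmono h3 _ _ _ _.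
- exact: J0.
exists t, st'; split=> //; case: h3 => z0 z1 z2 z3; split=> // b k l.
rewrite z3 /upd; case: (b == a) => //=; case: (ltnP k n) => //= _.
by rewrite andbT.
Qed.

(** Effect on memory and polynomial running time in one notion, closed under sequencing and loops; n
    > 0 lets additive constants be absorbed in n^k. *)
Definition computes (c : cmd) (k : nat)
    (F : nat -> nat -> nat -> memory -> memory) : Prop :=
  (forall x, x < 3 -> ~~ writes x c) /\
  exists C, forall n s u m st, 0 < n -> repr n s u m st ->
    exists t st', [/\ exec c st t st', t <= C * n ^ k & repr n s u (F n s u m) st'].

Lemma computes_Update a es e : a != 3 ->
  reads_within index_vars 3 es -> reads_within (7 :: index_vars) 3 e ->
  computes (Update a es e) 3 (fun n s u m => upd n (upd n m 3 (fillf n s u m es e)) a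
    (fillf n s u m es e)).
Proof.
move=> a3 wes we; split; first by case=> [|[|[|x]]].
(* Each of the two fills takes at most 3 n^3 + 6 n^2 + 4 n + 2 <= 15 n^3 steps. *)
exists 40 => n s u m st n0 hr.
have [t1 [st1 [h1 h2 h3]]] := exec_Fill wes we hr.
have [||t2 [st2 [g1 g2 g3]]] :=
  @exec_Fill a (Cst 0) (Cell 3 (Var 3) (Var 4)) _ _ _ _ _ _ _ h3.
- by [].
- by rewrite /= eq_sym a3.
exists (t1 + t2), st2; split; first exact: exec_Seq h1 g1.
  have e3 : n ^ 3 = n * n * n by rewrite !expnS expn0 muln1 mulnA.
  rewrite e3; nia.
case: g3 => v0 v1 v2 ha; split=> // b i j; rewrite ha /upd /fillf /=.
by case: (b == a) => //=; case: ((i < n) && (j < n)).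
Qed.

Lemma computes_Seq c1 k1 F1 c2 k2 F2 : computes c1 k1 F1 -> computes c2 k2 F2 ->
  computes (Seq c1 c2) (maxn k1 k2) (fun n s u m => F2 n s u (F1 n s u m)).
Proof.
move=> [w1 [C1 h1]] [w2 [C2 h2]]; split.
  by move=> x lx /=; rewrite negb_or w1 ?w2.
exists (C1 + C2) => n s u m st n0 hr.
have [t1 [st1 [e1 l1 r1]]] := h1 _ _ _ _ _ n0 hr.
have [t2 [st2 [e2 l2 r2]]] := h2 _ _ _ _ _ n0 r1.
exists (t1 + t2), st2; split=> //; first exact: exec_Seq e1 e2.
rewrite mulnDl; apply: leq_add.
  by apply: leq_trans l1 _; rewrite leq_mul2l leq_pexp2l ?leq_maxl ?orbT.
by apply: leq_trans l2 _; rewrite leq_mul2l leq_pexp2l ?leq_maxr ?orbT.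
Qed.

Lemma computes_ext c k F F' : computes c k F ->
  (forall n s u m a i j, F n s u m a i j = F' n s u m a i j) -> computes c k F'.
Proof.
move=> [w [C h]] e; split=> //; exists C => n s u m st n0 hr.
have [t [st' [h1 h2 [v0 v1 v2 ha]]]] := h _ _ _ _ _ n0 hr.
by exists t, st'; split=> //; split=> // a i j; rewrite ha.
Qed.

Lemma loop_time C n k : 0 < n -> n * (C * n ^ k + 2) + 2 <= (C + 4) * n ^ k.+1.
Proof.
move=> n0; rewrite expnS; have : 0 < n ^ k by rewrite expn_gt0 n0.
move: (n ^ k) => e; nia.
Qed.

Lemma computes_Rep c k F : ~~ writes 6 c -> computes c k F ->
  computes (For 6 c) k.+1 (fun n s u m => iter n (F n s u) m).
Proof.
move=> w6 [w [C h]]; split.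
  by move=> x lx /=; rewrite (negbTE (w _ lx)) //=; case: x lx => [|[|[|]]].
exists (C + 4) => n s u m st n0 hr; have [v0 v1 v2 ha] := hr.
have [||||||t [st' [h1 h2 h3]]] := @exec_For 6 c n (C * n ^ k)
  (fun i st => repr n s u (iter i (F n s u) m) st) st => //.
- exact: w.
- move=> i st0 _ _ _ hi; have [t [st' [h1 h2 h3]]] := h _ _ _ _ _ n0 hi.
  by exists t, st'; split=> //; case: h3 => *; split.
exists t, st'; split=> //; apply: leq_trans h2 _; exact: loop_time.
Qed.

(** The counter is variable 2, so round i runs c with i as failing vertex; hence [iteri] instead of
    [iter]. *)
Lemma exec_For_computes c k F : computes c k F ->
  exists C, forall n s m st, 0 < n -> repr n s 0 m st -> exists t st',
  [/\ exec (For 2 c) st t st', t <= C * n ^ k.+1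
    & forall a i j, arrs st' a i j = iteri n (F n s) m a i j].
Proof.
move=> [w [C h]]; exists (C + 4) => n s m st n0 hr; have [v0 v1 v2 ha] := hr.
have [||||||t [st' [h1 h2 h3]]] := @exec_For 2 c n (C * n ^ k)
  (fun i st => repr n s i (iteri i (F n s) m) st) st => //.
- exact: w.
- exact: w.
- move=> i st0 _ _ _ hi; have [t [st' [h1 h2 h3]]] := h _ _ _ _ _ n0 hi.
  by exists t, st'; split=> //; case: h3 => *; split.
exists t, st'; split=> //; last by case: h3.
by apply: leq_trans h2 _; exact: loop_time.
Qed.

(** * Boolean operations from truncated subtraction *)

Definition eqE a b := Minus (Cst 1) (Plus (Minus a b) (Minus b a)).
Definition ltE a b := Minus (Cst 1) (Minus (Plus a (Cst 1)) b).
Definition notE a := Minus (Cst 1) a.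
Definition andE a b := notE (Plus (notE a) (notE b)).
Definition orE a b := notE (notE (Plus a b)).

Lemma eval_eqE st a b : eval st (eqE a b) = (eval st a == eval st b).
Proof. by rewrite /=; case: eqP => /= ?; lia. Qed.

Lemma eval_ltE st a b : eval st (ltE a b) = (eval st a < eval st b).
Proof. by rewrite /=; case: ltnP => /= ?; lia. Qed.

Lemma eval_notE st a : eval st (notE a) = (eval st a == 0).
Proof. by rewrite /=; case: eqP => /= ?; lia. Qed.

Lemma eval_andE st a b :
  eval st (andE a b) = (0 < eval st a) && (0 < eval st b).
Proof. by rewrite /=; case: (eval st a) => [|k]; case: (eval st b) => [|l]. Qed.

Lemma eval_orE st a b :
  eval st (orE a b) = (0 < eval st a) || (0 < eval st b).
Proof. by rewrite /=; case: (eval st a) => [|k]; case: (eval st b) => [|l]. Qed.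

Lemma eval_Cell st a e1 e2 :
  eval st (Cell a e1 e2) = arrs st a (eval st e1) (eval st e2).
Proof. by []. Qed.

Lemma eval_Var st x : eval st (Var x) = vars st x.
Proof. by []. Qed.

Lemma eqb0n (b : bool) : (b == 0 :> nat) = ~~ b.
Proof. by case: b. Qed.

Definition evalE := (eval_eqE, eval_ltE, eval_notE, eval_andE, eval_orE,
  eval_Cell, eval_Var, lt0b, eqb0n).

Definition stores n (m : memory) a (f : 'I_n -> 'I_n -> nat) : Prop :=
  forall i j : 'I_n, m a i j = f i j.

Lemma stores_upd n m a (g : nat -> nat -> nat) (f : 'I_n -> 'I_n -> nat) :
  (forall i j : 'I_n, g i j = f i j) -> stores (upd n m a g) a f.
Proof. by move=> gf i j; rewrite /upd eqxx !ltn_ord gf. Qed.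

Lemma sum_bool_gt0 n (Q : pred 'I_n) :
  (0 < \sum_(z < n) Q z) = [exists z, Q z].
Proof.
rewrite lt0n sum_nat_eq0 negb_forall; apply: eq_existsb => z.
by rewrite /= eqb0n negbK.
Qed.

(** A sum of booleans is positive exactly when one is true, so the summation evaluates an
    existential quantifier. *)
Lemma fillf_exists n s u m es e (i j : 'I_n) (Q : pred 'I_n) v :
  (forall z : 'I_n, eval (State (env n s u i j z 0) m) es = Q z) ->
  (forall acc, (0 < acc) = [exists z, Q z] ->
     eval (State (env n s u i j n acc) m) e = v) ->
  fillf n s u m es e i j = v.
Proof.
move=> hQ hv; apply: hv; rewrite -sum_bool_gt0.
by under eq_bigr do rewrite hQ.
Qed.

(** * Distances, first indices and parents in arrays *)

Local Notation N := (Var 0).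
Local Notation Sr := (Var 1).
Local Notation U := (Var 2).
Local Notation I := (Var 3).
Local Notation J := (Var 4).
Local Notation Z := (Var 5).
Local Notation Acc := (Var 7).
Local Notation None0 := (Cst 0).
Definition posE a := notE (notE a).

Lemma eval_posE st a : eval st (posE a) = (0 < eval st a).
Proof. by rewrite !evalE -lt0n. Qed.

Definition updateF a es e n s u m :=
  upd n (upd n m 3 (fillf n s u m es e)) a (fillf n s u m es e).

(* Array 8 holds the vertices reached in at most k rounds. *)
Definition dist_count D := Plus (Cell D I J) (notE (Cell 8 I J)).
Definition dist_some a := andE (Cell 8 I Z) (Cell a Z J).
Definition dist_or := orE (Cell 8 I J) Acc.

Definition dist_prog a D : cmd :=
  Seq (Update D None0 (Cst 0)) (Seq (Update 8 None0 (eqE I J))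
  (For 6 (Seq (Update D None0 (dist_count D)) (Update 8 (dist_some a) dist_or)))).

Definition dist_iter a D n s u m k : memory :=
  iter k (fun m => updateF 8 (dist_some a) dist_or n s u
                     (updateF D None0 (dist_count D) n s u m))
    (updateF 8 None0 (eqE I J) n s u (updateF D None0 (Cst 0) n s u m)).

(** Agrees cell by cell with the iteration, but displays that only arrays 3, 8 and D can change. *)
Definition distF a D n s u m : memory := let M := dist_iter a D n s u m n in
  upd n (upd n (upd n m 3 (M 3)) 8 (M 8)) D (M D).

Lemma updateF_other a es e n s u m b i j :
  b != a -> b != 3 -> updateF a es e n s u m b i j = m b i j.
Proof. by rewrite /updateF /upd => /negbTE -> /negbTE ->. Qed.

Lemma updateF_out a es e n s u m b i j :
  ~~ ((i < n) && (j < n)) -> updateF a es e n s u m b i j = m b i j.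
Proof. by rewrite /updateF /upd => /negbTE ->; rewrite !andbF. Qed.

Lemma computes_dist a D : a != 3 -> D != 3 -> computes (dist_prog a D) 4 (distF a D).
Proof.
move=> a3 D3.
have iD e : reads_within (7 :: index_vars) 3 e ->
    computes (Update D None0 e) 3 (updateF D None0 e).
  by move=> we; apply: computes_Update.
have i8 es e : reads_within index_vars 3 es -> reads_within (7 :: index_vars) 3 e ->
    computes (Update 8 es e) 3 (updateF 8 es e).
  by move=> wes we; apply: computes_Update.
have wD : reads_within (7 :: index_vars) 3 (dist_count D) by rewrite /= D3.
have wa : reads_within index_vars 3 (dist_some a) by rewrite /= a3.
have hb := computes_Seq (iD _ wD) (i8 _ dist_or wa isT).
have hr := computes_Rep (c := Seq (Update D _ (dist_count D))
    (Update 8 (dist_some a) dist_or))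
  isT hb.
have h := computes_Seq (iD (Cst 0) isT) (computes_Seq (i8 None0 (eqE I J) isT isT) hr).
apply: (computes_ext h) => n s u m b i j; rewrite -/(dist_iter a D n s u m n).
rewrite /distF /upd.
case out: ((i < n) && (j < n)); rewrite ?andbT ?andbF.
  case: eqP => [-> //|/eqP bD]; case: eqP => [-> //|/eqP b8].
  case: eqP => [-> //|/eqP b3].
  by rewrite /dist_iter; elim: (X in iter X) => [|k IH] /=; rewrite !updateF_other.
move/negbT in out.
by rewrite /dist_iter; elim: (X in iter X) => [|k IH] /=; rewrite !updateF_out.
Qed.

Section Tables.
Variables (n : nat) (s : 'I_n).
Implicit Types (r : rel 'I_n) (m : memory).
Local Notation stores := (@stores n).

Lemma stores_update_exists a es e u m (Q : 'I_n -> 'I_n -> pred 'I_n) f :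
  (forall i j z : 'I_n, eval (State (env n s u i j z 0) m) es = Q i j z) ->
  (forall (i j : 'I_n) acc, (0 < acc) = [exists z, Q i j z] ->
     eval (State (env n s u i j n acc) m) e = f i j) ->
  stores (updateF a es e n s u m) a f.
Proof.
move=> hes he; apply: stores_upd => i j.
by apply: (@fillf_exists _ _ _ _ _ _ _ _ (Q i j)) => *; rewrite ?hes // (he i j).
Qed.

Lemma stores_update a e u m f :
  (forall (i j : 'I_n) acc, eval (State (env n s u i j n acc) m) e = f i j) ->
  stores (updateF a None0 e n s u m) a f.
Proof.
by move=> he; apply: (@stores_update_exists _ _ _ _ _ (fun _ _ => xpred0)).
Qed.

(** After k rounds array 8 holds [reach r k] and array D the first k summands of [nd]. A round
    updates D before 8, so D sees the value for k; n rounds complete the sum. *)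
Lemma stores_dist a D u m r : a != 3 -> D != 3 -> a != 8 -> a != D -> D != 8 ->
  stores m a (fun i j => r i j) ->
  stores (distF a D n s u m) D (fun i j => nd r i j).
Proof.
move=> a3 D3 a8 aD D8 ha; apply: stores_upd => i j; rewrite /nd card_ord.
suff H k : [/\ stores (dist_iter a D n s u m k) a (fun i j => r i j),
    stores (dist_iter a D n s u m k) 8 (fun i j => reach r k i j)
  & stores (dist_iter a D n s u m k) D (fun i j => \sum_(l < k) ~~ reach r l i j)].
  by case: (H n) => _ _ ->.
elim: k {i j} => [|k [IHa IH8 IHD]].
  rewrite /dist_iter /=; split=> [i j||i j].
  - by rewrite !updateF_other.
  - by apply: stores_update => i j acc; rewrite !evalE.
  - rewrite updateF_other // big_ord0.
    by rewrite (@stores_update D (Cst 0) _ _ (fun _ _ => 0)).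
rewrite /dist_iter iterS -/(dist_iter a D n s u m k).
move: (dist_iter _ _ _ _ _ _ _) IHa IH8 IHD => M IHa IH8 IHD.
have h8 : stores (updateF D None0 (dist_count D) n s u M) 8 (fun i j => reach r k i j).
  by move=> i j; rewrite updateF_other // eq_sym.
have ha' : stores (updateF D None0 (dist_count D) n s u M) a (fun i j => r i j).
  by move=> i j; rewrite updateF_other.
split=> [i j||i j].
- by rewrite !updateF_other.
- apply: (@stores_update_exists _ _ _ _ _ (fun i j z => reach r k i z && r z j)).
    by move=> i j z; rewrite /dist_some !evalE /= h8 ha' !lt0b.
  by move=> i j acc hacc; rewrite /dist_or !evalE /= h8 lt0b hacc.
rewrite updateF_other // big_ord_recr /=.
rewrite (@stores_update _ _ _ _ (fun i j =>
  \sum_(l < k) ~~ reach r l i j + ~~ reach r k i j)) //.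
by move=> {}i {}j acc; rewrite /= IHD IH8; case: reach.
Qed.

(** Counts the smaller indices marked in row i of array Q; [first_val] keeps a marked entry when
    there are none. *)
Definition first_sum Q := andE (ltE Z J) (Cell Q I Z).
Definition first_val Q := andE (Cell Q I J) (notE Acc).

Lemma stores_first Q F u m (q : rel 'I_n) :
  stores m Q (fun i j => q i j) ->
  stores (updateF F (first_sum Q) (first_val Q) n s u m) F (fun i j => first (q i) j).
Proof.
move=> h; apply: (@stores_update_exists _ _ _ _ _ (fun i j z => (z < j) && q i z)).
  by move=> i j z; rewrite /first_sum !evalE /= h lt0b.
by move=> i j acc hacc; rewrite /first_val !evalE /= h lt0b -leqn0 leqNgt hacc.
Qed.

Definition cand_val a D :=
  andE (Cell a J I) (eqE (Plus (Cell D Sr J) (Cst 1)) (Cell D Sr I)).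
(** Array 21 is scratch here; [faultF] fills it with the added edges only after both calls. *)
Definition parentF a D F n s u m :=
  updateF F (first_sum 21) (first_val 21) n s u (updateF 21 None0 (cand_val a D) n s u m).

Lemma stores_parent a D F u m r :
  stores m a (fun i j => r i j) -> stores m D (fun i j => nd r i j) ->
  stores (parentF a D F n s u m) F (fun i j => bfs_parent r s i j).
Proof.
move=> ha hD; apply: stores_first.
by apply: stores_update => i j acc; rewrite /cand_val !evalE /= ha !hD addn1 lt0b.
Qed.

Lemma nd_lt_connect r x y : (nd r x y < n) = connect r x y.
Proof. by rewrite -nd_connect card_ord. Qed.

End Tables.

(** This and the next two frame rules carry known array contents past a program step. *)
Lemma frame_update n s a es e u m b (f : 'I_n -> 'I_n -> nat) :
  b \notin [:: 3; a] -> stores m b f -> stores (updateF a es e n s u m) b f.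
Proof. by rewrite !inE !negb_or => /andP[b3 ba] h i j; rewrite updateF_other // h. Qed.

Lemma frame_dist n s a D u m b (f : 'I_n -> 'I_n -> nat) :
  b \notin [:: 3; 8; D] -> stores m b f -> stores (distF a D n s u m) b f.
Proof.
rewrite !inE !negb_or => /and3P[/negbTE b3 /negbTE b8 /negbTE bD] h i j.
by rewrite /distF /upd bD b8 b3 h.
Qed.

Lemma frame_parent n s a D F u m b (f : 'I_n -> 'I_n -> nat) :
  b \notin [:: 3; 21; F] -> stores m b f -> stores (parentF a D F n s u m) b f.
Proof.
rewrite !inE !negb_or => /and3P[b3 b21 bF] h i j.
by rewrite /parentF !updateF_other // h.
Qed.

Definition parent_prog a D F : cmd :=
  Seq (Update 21 None0 (cand_val a D)) (Update F (first_sum 21) (first_val 21)).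

Lemma computes_parent a D F : a != 3 -> D != 3 -> F != 3 ->
  computes (parent_prog a D F) 3 (parentF a D F).
Proof.
move=> a3 D3 F3; apply: (@computes_Seq _ 3 (updateF 21 None0 (cand_val a D))
    _ 3 (updateF F (first_sum 21) (first_val 21))).
  by apply: computes_Update; rewrite //= a3 D3.
exact: computes_Update.
Qed.

(** * The algorithm *)

(* Arrays. Global: 4 distances in G, 5 tree parents, 6 distances along parents,
   7 subtree sizes. For the current failing vertex u: 9 heavy subtree, 10-12
   adjacency, distances and parents in G - u, 13-15 the same outside the heavy
   subtree, 16 entry edges, 18 and 20 the ends of the selected one, 21 the edges
   added for u. Arrays 7, 9, 18 and 20 hold vectors, constant in one index. *)
Definition below_cell i u := ltE (Cell 6 i u) N.
Definition heavy_cell v :=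
  andE (Cell 5 v U) (ltE (Cell 7 U U) (Plus (Cell 7 v v) (Cell 7 v v))).
Definition inD_sum := andE (heavy_cell Z) (below_cell I Z).
Definition del_val := andE (notE (eqE I U)) (andE (notE (eqE J U)) (Cell 0 I J)).
Definition outer_val := andE (Cell 10 I J) (andE (notE (Cell 9 I I)) (notE (Cell 9 J J))).
Definition entry_sum := andE (heavy_cell Z)
  (eqE (Plus (Cell 14 Sr I) (Cell 4 Sr J)) (Plus (Cell 11 Sr Z) (Cell 4 Sr U))).
Definition entry_val := andE (Cell 10 I J) (andE (notE (Cell 9 I I))
  (andE (Cell 9 J J) (andE (ltE (Cell 14 Sr I) N) Acc))).
Definition dst_sum := andE (Cell 18 Z Z) (Cell 16 Z J).
Definition ext_val := orE
  (andE (andE (below_cell I U) (andE (notE (eqE I U)) (notE (Cell 9 I I))))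
        (orE (Cell 12 I J) (Cell 15 I J)))
  (andE (Cell 18 I I) (Cell 20 I J)).

Definition setup : cmd :=
  Seq (dist_prog 0 4) (Seq (parent_prog 0 4 5) (Seq (dist_prog 5 6)
  (Seq (Update 7 (below_cell Z I) Acc)
       (Update 2 None0 (orE (Cell 1 I J) (orE (Cell 5 I J) (Cell 5 J I))))))).

Definition setupF n s u m : memory :=
  let m := distF 0 4 n s u m in
  let m := parentF 0 4 5 n s u m in
  let m := distF 5 6 n s u m in
  let m := updateF 7 (below_cell Z I) Acc n s u m in
  updateF 2 None0 (orE (Cell 1 I J) (orE (Cell 5 I J) (Cell 5 J I))) n s u m.

Definition fault : cmd :=
  Seq (Update 9 inD_sum (posE Acc))
  (Seq (Update 10 None0 del_val) (Seq (dist_prog 10 11) (Seq (parent_prog 10 11 12)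
  (Seq (Update 13 None0 outer_val) (Seq (dist_prog 13 14) (Seq (parent_prog 13 14 15)
  (Seq (Update 16 entry_sum entry_val)
  (Seq (Update 17 (Cell 16 J Z) (posE Acc)) (Seq (Update 18 (first_sum 17) (first_val 17))
  (Seq (Update 19 dst_sum (posE Acc)) (Seq (Update 20 (first_sum 19) (first_val 19))
  (Seq (Update 21 None0 ext_val)
       (Update 2 None0 (orE (Cell 2 I J) (orE (Cell 21 I J) (Cell 21 J I)))))))))))))))).

Definition faultF n s u m : memory :=
  let m := updateF 9 inD_sum (posE Acc) n s u m in
  let m := updateF 10 None0 del_val n s u m in
  let m := distF 10 11 n s u m in
  let m := parentF 10 11 12 n s u m in
  let m := updateF 13 None0 outer_val n s u m in
  let m := distF 13 14 n s u m in
  let m := parentF 13 14 15 n s u m in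
  let m := updateF 16 entry_sum entry_val n s u m in
  let m := updateF 17 (Cell 16 J Z) (posE Acc) n s u m in
  let m := updateF 18 (first_sum 17) (first_val 17) n s u m in
  let m := updateF 19 dst_sum (posE Acc) n s u m in
  let m := updateF 20 (first_sum 19) (first_val 19) n s u m in
  let m := updateF 21 None0 ext_val n s u m in
  updateF 2 None0 (orE (Cell 2 I J) (orE (Cell 21 I J) (Cell 21 J I))) n s u m.

Lemma computes_setup : computes setup 4 setupF.
Proof.
have iL a es e : a != 3 ->
  reads_within index_vars 3 es -> reads_within (7 :: index_vars) 3 e ->
  computes (Update a es e) 3 (updateF a es e) := @computes_Update a es e.
exact: (computes_Seq (computes_dist (a := 0) (D := 4) isT isT)
  (computes_Seq (computes_parent (a := 0) (D := 4) (F := 5) isT isT isT)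
  (computes_Seq (computes_dist (a := 5) (D := 6) isT isT)
  (computes_Seq (iL 7 (below_cell Z I) Acc isT isT isT)
  (iL 2 None0 (orE (Cell 1 I J) (orE (Cell 5 I J) (Cell 5 J I))) isT isT isT))))).
Qed.

Lemma computes_fault : computes fault 4 faultF.
Proof.
have iL a es e : a != 3 ->
  reads_within index_vars 3 es -> reads_within (7 :: index_vars) 3 e ->
  computes (Update a es e) 3 (updateF a es e) := @computes_Update a es e.
exact: (computes_Seq (iL 9 inD_sum (posE Acc) isT isT isT)
  (computes_Seq (iL 10 None0 del_val isT isT isT)
  (computes_Seq (computes_dist (a := 10) (D := 11) isT isT)
  (computes_Seq (computes_parent (a := 10) (D := 11) (F := 12) isT isT isT)
  (computes_Seq (iL 13 None0 outer_val isT isT isT)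
  (computes_Seq (computes_dist (a := 13) (D := 14) isT isT)
  (computes_Seq (computes_parent (a := 13) (D := 14) (F := 15) isT isT isT)
  (computes_Seq (iL 16 entry_sum entry_val isT isT isT)
  (computes_Seq (iL 17 (Cell 16 J Z) (posE Acc) isT isT isT)
  (computes_Seq (iL 18 (first_sum 17) (first_val 17) isT isT isT)
  (computes_Seq (iL 19 dst_sum (posE Acc) isT isT isT)
  (computes_Seq (iL 20 (first_sum 19) (first_val 19) isT isT isT)
  (computes_Seq (iL 21 None0 ext_val isT isT isT)
  (iL 2 None0 (orE (Cell 2 I J) (orE (Cell 21 I J) (Cell 21 J I))) isT isT isT)))))))))))))).
Qed.

(** * Correctness of the tables *)

Section Correctness.
Variables (n : nat) (G S : sgraph 'I_n) (s : 'I_n).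
Local Notation stores := (@stores n).
Local Notation P := (bfs_parent G s).

(** The arrays computed once or given as input that every round reads and none overwrites. *)
Record tables (m : memory) : Prop := Tables {
  tab_G : stores m 0 (fun i j => G i j);
  tab_d : stores m 4 (fun i j => nd G i j);
  tab_P : stores m 5 (fun i j => P i j);
  tab_below : stores m 6 (fun i j => nd P i j);
  tab_sz : stores m 7 (fun i _ => sz G s i)
}.

(* [h] states the content of an array written by the last step. The other known
   facts are carried over that step, whose result is then made abstract. *)
Ltac advance h :=
  let go m fr M :=
    repeat match goal with
    | H : stores m _ _ |- _ => first [apply fr in H; [|by []] | clear H]
    end;
    generalize dependent M; clear m; intros m; intros in
  match type of h with
  | stores (updateF ?a ?es ?e ?k ?r ?u ?m) _ _ =>
      go m (@frame_update k r a es e u m) (updateF a es e k r u m)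
  | stores (distF ?a ?D ?k ?r ?u ?m) _ _ =>
      go m (@frame_dist k r a D u m) (distF a D k r u m)
  | stores (parentF ?a ?D ?F ?k ?r ?u ?m) _ _ =>
      go m (@frame_parent k r a D F u m) (parentF a D F k r u m)
  end.

Lemma setup_stores u m :
  stores m 0 (fun i j => G i j) -> stores m 1 (fun i j => S i j) ->
  tables (setupF n s u m) /\
  stores (setupF n s u m) 2 (fun i j => [|| S i j, P i j | P j i]).
Proof.
move=> h0 h1; rewrite /setupF.
have h4 : stores (distF 0 4 n s u m) 4 (fun i j => nd G i j).
  by apply: stores_dist.
advance h4.
have h5 : stores (parentF 0 4 5 n s u m) 5 (fun i j => P i j).
  by apply: stores_parent.
advance h5.
have h6 : stores (distF 5 6 n s u m) 6 (fun i j => nd P i j).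
  by apply: stores_dist.
advance h6.
have h7 : stores (updateF 7 (below_cell Z I) Acc n s u m) 7 (fun i _ => sz G s i).
  apply: stores_upd => i j; rewrite /fillf /sz -sum1_card [RHS]big_mkcond /=.
  rewrite -[LHS]/(\sum_(z < n) eval (State (env n s u i j z 0) m) (below_cell Z I)).
  apply: eq_bigr => z _; rewrite /below_cell !evalE /=.
  by rewrite h6 nd_lt_connect inE /below; case: (connect _ _ _).
advance h7.
split; last first.
  apply: stores_update => i j acc; rewrite !evalE /=.
  by rewrite !h5 h1 !lt0b.
by split; apply: frame_update.
Qed.

Lemma fault_stores (u : 'I_n) m (K : rel 'I_n) :
  tables m -> stores m 2 (fun i j => K i j) ->
  tables (faultF n s u m) /\
  stores (faultF n s u m) 2 (fun i j => K i j || (ext G s u i j || ext G s u j i)).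
Proof.
move=> [h0 h4 h5 h6 h7] h2; rewrite /faultF.
(* Stated for an arbitrary memory, as it serves both for D and for the entry edges. *)
have heavyE m' (i j z : 'I_n) acc : stores m' 5 (fun i j => P i j) ->
    stores m' 7 (fun i _ => sz G s i) ->
    eval (State (env n s u i j z acc) m') (heavy_cell Z) = heavy G s u z.
  by move=> h5' h7'; rewrite /heavy_cell !evalE /= h5' !h7' lt0b.
have h9 : stores (updateF 9 inD_sum (posE Acc) n s u m) 9 (fun i _ => inD G s u i).
  apply: (@stores_update_exists _ _ _ _ _ _ _
    (fun i _ z => heavy G s u z && below G s z i)).
    move=> i j z; rewrite /inD_sum eval_andE heavyE // lt0b.
    by rewrite /below_cell !evalE /= h6 nd_lt_connect.
  by move=> i j acc hacc; rewrite eval_posE /= hacc.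
advance h9.
have h10 : stores (updateF 10 None0 del_val n s u m) 10 (fun i j => del_vertex G u i j).
  by apply: stores_update => i j acc; rewrite /del_val !evalE /= h0 !lt0b.
advance h10.
have h11 : stores (distF 10 11 n s u m) 11 (fun i j => nd (del_vertex G u) i j).
  by apply: stores_dist.
advance h11.
have h12 : stores (parentF 10 11 12 n s u m) 12
  (fun i j => bfs_parent (del_vertex G u) s i j).
  by apply: stores_parent.
advance h12.
have h13 : stores (updateF 13 None0 outer_val n s u m) 13 (fun i j => outer G s u i j).
  by apply: stores_update => i j acc; rewrite /outer_val !evalE /= h10 !h9 !evalE.
advance h13.
have h14 : stores (distF 13 14 n s u m) 14 (fun i j => nd (outer G s u) i j).
  by apply: stores_dist.
advance h14.
have h15 : stores (parentF 13 14 15 n s u m) 15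
  (fun i j => bfs_parent (outer G s u) s i j).
  by apply: stores_parent.
advance h15.
have h16 : stores (updateF 16 entry_sum entry_val n s u m) 16
  (fun i j => entry G s u i j).
  apply: (@stores_update_exists _ _ _ _ _ _ _ (fun x z v => heavy G s u v &&
     (nd (outer G s u) s x + nd G s z == nd (del_vertex G u) s v + nd G s u))).
    by move=> i j z; rewrite /entry_sum eval_andE heavyE // !evalE /= h14 !h4 h11.
  move=> i j acc hacc; rewrite /entry_val !evalE /= hacc.
  by rewrite h10 !h9 h14 !evalE.
advance h16.
have h17 : stores (updateF 17 (Cell 16 J Z) (posE Acc) n s u m)
    17 (fun _ j => [exists z, entry G s u j z]).
  apply: (@stores_update_exists _ _ _ _ _ _ _ (fun _ j z => entry G s u j z)).
    by move=> i j z; rewrite evalE /= h16.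
  by move=> i j acc hacc; rewrite eval_posE /= hacc.
advance h17.
have h18 : stores (updateF 18 (first_sum 17) (first_val 17) n s u m)
    18 (fun _ j => entry_src G s u j).
  exact: (@stores_first n s 17 18 u m (fun _ j => [exists z, entry G s u j z])).
advance h18.
have h19 : stores (updateF 19 dst_sum (posE Acc) n s u m) 19 (fun _ j =>
    [exists x, entry_src G s u x && entry G s u x j]).
  apply: (@stores_update_exists _ _ _ _ _ _ _
    (fun _ j z => entry_src G s u z && entry G s u z j)).
    by move=> i j z; rewrite /dst_sum !evalE /= h18 h16 !lt0b.
  by move=> i j acc hacc; rewrite eval_posE /= hacc.
advance h19.
have h20 : stores (updateF 20 (first_sum 19) (first_val 19) n s u m)
    20 (fun _ j => entry_dst G s u j).
  exact: (@stores_first n s 19 20 u m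
    (fun _ j => [exists x, entry_src G s u x && entry G s u x j])).
advance h20.
have h21 : stores (updateF 21 None0 ext_val n s u m) 21 (fun i j => ext G s u i j).
  apply: stores_update => i j acc; rewrite /ext_val /below_cell !evalE /=.
  by rewrite h6 h9 h12 h15 h18 h20 !evalE nd_lt_connect.
advance h21.
split; last first.
  apply: stores_update => i j acc; rewrite !evalE /=.
  by rewrite !h21 h2 !evalE.
by split; apply: frame_update.
Qed.

Lemma iteri_fault_stores m k : k <= n ->
  tables m -> stores m 2 (fun i j => [|| S i j, P i j | P j i]) ->
  tables (iteri k (faultF n s) m) /\
  stores (iteri k (faultF n s) m) 2 (fun i j => [|| S i j, P i j, P j i |
    [exists u : 'I_n, (u < k) && (ext G s u i j || ext G s u j i)]]).
Proof.
elim: k => [|k IH] kn ht h2.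
  split=> // i j; rewrite [LHS]h2 (_ : [exists u, _] = false) ?orbF //.
  by apply/existsP => -[u]; rewrite ltn0.
have [ht' h2'] := IH (ltnW kn) ht h2.
have [ht'' h2''] := fault_stores (Ordinal kn) ht' h2'.
split=> // i j; rewrite [LHS]h2''; congr nat_of_bool.
case: (S i j) => //=; case: (P i j) => //=; case: (P j i) => //=.
apply/orP/existsP => [[/existsP[u /andP[uk h]]|h]|[u /andP[]]].
- by exists u; rewrite h ltnS ltnW.
- by exists (Ordinal kn); rewrite h ltnSn.
rewrite ltnS leq_eqVlt => /orP[/eqP uk|uk] h; [right|left].
  by have -> : Ordinal kn = u by exact: val_inj.
by apply/existsP; exists u; rewrite uk.
Qed.

End Correctness.

Local Open Scope ring_scope.

Theorem theorem3 (R : realType) :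
  exists (pi : cmd) (c k : nat) (C : R),
  forall (n : nat) (G : sgraph 'I_n) (s : 'I_n) (alpha beta : R)
         (S : sgraph 'I_n),
    1 <= alpha -> 0 <= beta -> spanner alpha beta G S ->
    exists (t : nat) (st : state) (H : sgraph 'I_n),
      [/\ exec pi (input G s S) t st,
          (t <= c * n ^ k)%N,
          outputs st H,
          vabfs alpha beta G s H
        & (nb_edges H)%:R <= C * ((nb_edges S)%:R + n%:R * ln n%:R)].
Proof.
have [_ [C1 h1]] := computes_setup; have [C2 h2] := exec_For_computes computes_fault.
(* The setup and each of the n rounds take time of order n^4, whence the exponent 5. *)
exists (Seq setup (For 2 fault)), (C1 + C2)%N, 5%N, (1 + 4 / ln 2).
move=> n G s alpha beta S a1 b0 SP; have SG : subrel S G by case: SP.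
have n0 : (0 < n)%N := leq_ltn_trans (leq0n s) (ltn_ord s).
have [||t1 [st1 [e1 l1 r1]]] := h1 n s 0%N (arrs (input G s S)) (input G s S) => //.
have [t2 [st2 [e2 l2 r2]]] := h2 n s _ st1 n0 r1.
exists (t1 + t2)%N, st2, (out_graph s SG); split.
- exact: exec_Seq e1 e2.
- rewrite mulnDl; apply: leq_add => //; apply: leq_trans l1 _.
  by rewrite leq_mul2l leq_pexp2l ?orbT.
- have adjE (K : sgraph 'I_n) (i j : 'I_n) : adj_array K i j = K i j.
    by rewrite /adj_array !valK.
  have [ht hf] := @setup_stores n G S s 0 (arrs (input G s S)) (adjE G) (adjE S).
  have [_ hF] := @iteri_fault_stores n G S s _ n (leqnn n) ht hf.
  (* After n rounds the condition u < n holds for every vertex u. *)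
  move=> x y; rewrite r2 hF /=; congr nat_of_bool; do 3 congr orb.
  by apply: eq_existsb => u; rewrite ltn_ord.
- exact: out_graph_vabfs.
- exact: nb_edges_out_graph_log.
Qed.
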